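(* As $k\to\infty$, \[ R(3,k)\geq \Big(\frac{1}{3}+o(1)\Big)\frac{k^2}{\log k}. \] Equivalently, for every $\varepsilon>0$ and all sufficiently large $k$, there exists a triangle-free graph on at least $(1/3-\varepsilon)k^2/\log k$ vertices containing no independent set of size $k$.
   Context: $R(3,k)$ denotes the Ramsey number: the least $n$ such that every graph on $n$ vertices contains either a triangle or an independent set of size $k$. Logarithms are natural. *)

(* Defs.v *)
From mathcomp Require Import all_boot.
Set Implicit Arguments. Unset Strict Implicit. Unset Printing Implicit Defensive.

Definition simple_graph (n : nat) (e : rel 'I_n) : Prop :=
  symmetric e /\ irreflexive e.

Definition has_triangle (n : nat) (e : rel 'I_n) : Prop :=
  exists x y z : 'I_n, [&& e x y, e y z & e x z].

Definition independent (n : nat) (e : rel 'I_n) (S : {set 'I_n}) : Prop :=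
  forall x y, x \in S -> y \in S -> ~~ e x y.

(* ramsey3 n k : every graph on n vertices contains a triangle or an
   independent set of size k.  R(3,k) is the least n with ramsey3 n k. *)
Definition ramsey3 (n k : nat) : Prop :=
  forall e : rel 'I_n, simple_graph e ->
    has_triangle e \/ exists S : {set 'I_n}, independent e S /\ #|S| = k.

(* Main.v *)
Require Import Defs.
From mathcomp Require Import all_boot all_order all_algebra.
From mathcomp Require Import reals sequences exp ring lra zify.
Set Implicit Arguments. Unset Strict Implicit. Unset Printing Implicit Defensive.
Import Order.TTheory GRing.Theory Num.Theory.
Local Open Scope ring_scope.

(** Random blocks: the [n] vertices are projected twice, independently and
    uniformly, onto a set of [m] blocks with [m] smaller than [n] by a power of
    [log k]; two independent random graphs of density [p = (5/4) log k / k], one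
    red and one blue, live on the blocks and are pulled back to the vertices. In
    a reduced graph two blocks typically have no common neighbour, so very few
    edges are lost when one deletes every edge whose ends have a common neighbour
    in the other colour, or a common neighbour of their own colour in a block
    larger than both; by pigeonhole the remaining graph is triangle-free.

    Let [I] be an independent [k]-set, projecting onto [jR] red and [jB] blue
    blocks. All red edges between its red blocks were deleted. Pairs of blocks
    are closed either lightly, in which case only few of them carry an edge, or
    because they lie in one of boundedly many blue neighbourhoods that meet [I] in
    a positive proportion. Each neighbourhood has at most [0.43 k] vertices, and
    the part of [I] inside them meets few blue blocks, hence has at most
    [k - jB + o(k)] elements; so at most [0.43 k (k - jB + o(k)) / 2] pairs are
    closed in this way, and the others carry few red edges. The same holds
    with the colours exchanged, and the two events are independent. On the other
    side, random projections make sets with few blocks rare: there are about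
    [exp ((jR + jB - k) log k)] sets with these block numbers. With
    [a = 1 - jB / k] the union bound succeeds because
    [5/8 ((1 - a)^2 - 0.43 a) + a > 1/2] on [[0, 1]]. *)

(** * Finite product spaces *)

(** Stands for measurability with respect to the coordinates in [G]; disjoint coordinate sets then
    give independence. *)
Definition depends_on (A T : finType) (U : Type) (G : pred A)
    (f : {ffun A -> T} -> U) :=
  forall w w' : {ffun A -> T}, (forall a, G a -> w a = w' a) -> f w = f w'.

Section ProductSpace.
Variables (R : realType) (A T : finType) (mu : T -> R).
Implicit Types (f g : {ffun A -> T} -> R) (P Q : {ffun A -> T} -> bool).

Definition weight (w : {ffun A -> T}) : R := \prod_a mu (w a).
Definition Ex f : R := \sum_w weight w * f w.
Definition Pr P : R := Ex (fun w => (P w)%:R).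

Lemma Ex_ext f g : f =1 g -> Ex f = Ex g.
Proof. by move=> fg; apply: eq_bigr => w _; rewrite fg. Qed.

Lemma ExD f g : Ex (fun w => f w + g w) = Ex f + Ex g.
Proof. by rewrite -big_split; apply: eq_bigr => w _; rewrite mulrDr. Qed.

Lemma ExZ c f : Ex (fun w => c * f w) = c * Ex f.
Proof. by rewrite big_distrr; apply: eq_bigr => w _; rewrite mulrCA. Qed.

Lemma Ex_sum (I : Type) (r : seq I) (K : pred I) (F : I -> {ffun A -> T} -> R) :
  Ex (fun w => \sum_(i <- r | K i) F i w) = \sum_(i <- r | K i) Ex (F i).
Proof.
by rewrite /Ex exchange_big; apply: eq_bigr => w _; rewrite big_distrr.
Qed.

Hypothesis mu_ge0 : forall t, 0 <= mu t.
Hypothesis mu_sum : \sum_t mu t = 1.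

Lemma weight_ge0 w : 0 <= weight w.
Proof. by apply: prodr_ge0. Qed.

Lemma weight_sum : \sum_w weight w = 1.
Proof.
rewrite -[LHS](@bigA_distr_bigA _ _ _ _ _ _ _ (fun _ : A => mu)).
by rewrite big1 // => a _; exact: mu_sum.
Qed.

Lemma Ex_cst c : Ex (fun=> c) = c.
Proof. by rewrite /Ex -big_distrl /= weight_sum mul1r. Qed.

Lemma Ex_le f g : (forall w, f w <= g w) -> Ex f <= Ex g.
Proof. by move=> fg; apply: ler_sum => w _; rewrite ler_wpM2l ?weight_ge0. Qed.

Lemma Ex_ge0 f : (forall w, 0 <= f w) -> 0 <= Ex f.
Proof. by move=> f0; apply: sumr_ge0 => w _; rewrite mulr_ge0 ?weight_ge0. Qed.

Lemma Pr_ge0 P : 0 <= Pr P.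
Proof. by apply: Ex_ge0 => w; rewrite ler0n. Qed.

Lemma Pr_sub P Q : (forall w, P w -> Q w) -> Pr P <= Pr Q.
Proof.
by move=> PQ; apply: Ex_le => w; case: (boolP (P w)) => [/PQ ->|_] //; exact: ler0n.
Qed.

Lemma Pr_markov P f : (forall w, 0 <= f w) -> (forall w, P w -> 1 <= f w) ->
  Pr P <= Ex f.
Proof. by move=> f0 Pf; apply: Ex_le => w; case: (boolP (P w)) => [/Pf|_]. Qed.

Lemma PrU P Q : Pr (fun w => P w || Q w) <= Pr P + Pr Q.
Proof.
by rewrite -ExD; apply: Ex_le => w; case: (P w); case: (Q w); rewrite /= ?addr0 ?add0r ?lerDl ?ler0n.
Qed.

Lemma Pr_exists_le (I : finType) (K : pred I) (F : I -> {ffun A -> T} -> bool) :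
  Pr (fun w => [exists i, K i && F i w]) <= \sum_(i | K i) Pr (F i).
Proof.
rewrite -Ex_sum; apply: Ex_le => w.
case: existsP => [[i /andP[Ki Fi]]|_]; last by apply: sumr_ge0 => i _; rewrite ler0n.
by rewrite (bigD1 i) //= Fi lerDl; apply: sumr_ge0 => j _; rewrite ler0n.
Qed.

(** The probabilistic method: the weights sum to 1, so [f] cannot be at least [c] everywhere. It
    selects both the projections and the graphs. *)
Lemma Ex_lt_exists f c : Ex f < c -> exists w, f w < c.
Proof.
move=> fc; apply/existsP; rewrite -[X in is_true X]negbK negb_exists.
apply/negP => /forallP cf; move: fc; rewrite ltNge -{1}[c]Ex_cst.
by rewrite Ex_le // => w; rewrite leNgt; exact: cf.
Qed.

(* Swapping the coordinates outside [G] between two independent samples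
   preserves the product weight. *)
Lemma Ex_indep (G : pred A) f g :
  depends_on G f -> depends_on (predC G) g ->
  Ex (fun w => f w * g w) = Ex f * Ex g.
Proof.
move=> Gf Gg.
pose mix (w w' : {ffun A -> T}) := [ffun a => if G a then w a else w' a].
pose s (z : {ffun A -> T} * {ffun A -> T}) := (mix z.1 z.2, mix z.2 z.1).
have sK : involutive s.
  by move=> [w w']; congr pair; apply/ffunP => a; rewrite !ffunE /=; case: (G a).
have -> : Ex f * Ex g =
    \sum_z (weight z.1 * weight z.2) * (f z.1 * g z.2).
  rewrite /Ex big_distrl /=.
  under eq_bigr do rewrite big_distrr /=.
  rewrite pair_bigA /=; apply: eq_bigr => z _; ring.
rewrite (reindex_inj (inv_inj sK)) /=.
transitivity (\sum_z (weight z.1 * weight z.2) * (f z.1 * g z.1)).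
  rewrite -(pair_bigA _ (fun w w' => weight w * weight w' * (f w * g w))) /=.
  apply: eq_bigr => w _; rewrite -big_distrl -big_distrr /=.
  by rewrite weight_sum mulr1.
apply: eq_bigr => -[w w'] _ /=; congr (_ * (_ * _)).
- rewrite /weight -!big_split; apply: eq_bigr => a _ /=; rewrite !ffunE.
  by case: (G a); rewrite // mulrC.
- by apply: Gf => a Ga; rewrite ffunE Ga.
- by apply: Gg => a /negPf Ga; rewrite ffunE Ga.
Qed.

Lemma Ex_prod_indep (I : eqType) (r : seq I) (G : I -> pred A)
    (F : I -> {ffun A -> T} -> R) :
  uniq r -> (forall i, i \in r -> depends_on (G i) (F i)) ->
  (forall i j a, i \in r -> j \in r -> G i a -> G j a -> i = j) ->
  Ex (fun w => \prod_(i <- r) F i w) = \prod_(i <- r) Ex (F i).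
Proof.
elim: r => [|i r IH] /= => [_ _ _|/andP[ir ur] dF dG].
  rewrite big_nil -[RHS]Ex_cst; apply: Ex_ext => w; exact: big_nil.
rewrite big_cons -IH //; last first.
- by move=> j l a jr lr; apply: dG; rewrite inE ?jr ?lr orbT.
- by move=> j jr; apply: dF; rewrite inE jr orbT.
rewrite -(@Ex_indep (G i)); last 2 first.
- by apply: dF; rewrite inE eqxx.
- move=> w w' ww'; apply: eq_big_seq => j jr.
  apply: (dF j); first by rewrite inE jr orbT.
  move=> a Ga; apply: ww'; apply/negP => Gi.
  have ij : i = j by apply: (dG i j a) => //; rewrite !inE ?eqxx ?jr ?orbT.
  by rewrite ij jr in ir.
by apply: Ex_ext => w; rewrite big_cons.
Qed.

Lemma Ex_coord a (h : T -> R) : Ex (fun w => h (w a)) = \sum_t mu t * h t.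
Proof.
(* Weight and [h] are merged into one product over the coordinates, so the sum over functions
   factors; each coordinate other than [a] contributes total mass 1. *)
pose F b t := mu t * (if b == a then h t else 1).
transitivity (\prod_b \sum_t F b t).
  rewrite bigA_distr_bigA; apply: eq_bigr => w _.
  rewrite /F big_split /=; congr (_ * _).
  by rewrite (bigD1 a) //= eqxx big1 ?mulr1 // => b /negPf ->.
rewrite (bigD1 a) //= /F eqxx [X in _ * X]big1 ?mulr1 // => b /negPf ->.
by under eq_bigr do rewrite mulr1.
Qed.

Lemma Ex_prod_coord (I : eqType) (r : seq I) (key : I -> A) (h : I -> T -> R) :
  uniq r -> {in r &, injective key} ->
  Ex (fun w => \prod_(i <- r) h i (w (key i))) =
  \prod_(i <- r) \sum_t mu t * h i t.
Proof.
move=> ur kinj; rewrite (@Ex_prod_indep _ _ (fun i => pred1 (key i))) //.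
- by apply: eq_bigr => i _; rewrite Ex_coord.
- by move=> i _ w w' ww'; rewrite ww' //=.
- by move=> i j a ir jr /= /eqP -> /eqP; exact: kinj.
Qed.

End ProductSpace.

(** * Tail bounds for Bernoulli variables *)

Lemma expR_le_inv (R : realType) (z : R) : z < 1 -> expR z <= (1 - z)^-1.
Proof.
move=> z1; rewrite -[z in expR z]opprK expRN lef_pV2 ?posrE ?expR_gt0 ?subr_gt0 //.
exact: expR_ge1Dx.
Qed.

(** Rests on (1 - z) (1 + z + 2 z^2) = 1 + z^2 (1 - 2 z), which is at least 1 for z at most 1/2. *)
Lemma expR_le_quad (R : realType) (z : R) : 0 <= z -> z <= 2^-1 ->
  expR z <= 1 + z + 2 * z ^+ 2.
Proof.
move=> z0 z2; have z1 : 0 < 1 - z by lra.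
apply: (le_trans (expR_le_inv _)); first by lra.
rewrite -div1r ler_pdivrMr //; nra.
Qed.

Lemma expR_le_lin (R : realType) (z : R) : 0 <= z -> z <= 2^-1 ->
  expR z <= 1 + 2 * z.
Proof. by move=> z0 z2; apply: (le_trans (expR_le_quad z0 z2)); nra. Qed.

(** A crude value suffices: it gives e - 1 <= 3, the source of the constant 3 in the upper tails
    taken at t = 1. *)
Lemma expR1_le4 (R : realType) : expR (1 : R) <= 4.
Proof.
have -> : (1 : R) = 2^-1 + 2^-1 by lra.
have h : expR (2^-1 : R) <= 2.
  by apply: (le_trans (expR_le_lin _ _)); rewrite ?lexx //; lra.
rewrite expRD; have := expR_gt0 (2^-1 : R); nra.
Qed.

Definition bern (R : realType) (p : R) (b : bool) : R := if b then p else 1 - p.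

Section Bernoulli.
Variables (R : realType) (p : R).
Hypotheses (p_ge0 : 0 <= p) (p_le1 : p <= 1).

Lemma bern_ge0 b : 0 <= bern p b.
Proof. by case: b; rewrite /bern //= subr_ge0. Qed.

Lemma bern_sum : \sum_b bern p b = 1.
Proof. by rewrite big_bool /= addrC subrK. Qed.

Lemma bern_mgf (t : R) :
  \sum_b bern p b * expR (t * b%:R) <= expR (p * (expR t - 1)).
Proof.
rewrite big_bool /= mulr0 mulr1 expR0; apply: le_trans (expR_ge1Dx _); lra.
Qed.

Section Tails.
Variable A : finType.

(** Chernoff's method. With both sides multiplied by [t], one statement is an upper tail for t > 0
    and a lower tail for t < 0. *)
Lemma weighted_tail (I : eqType) (r : seq I) (key : I -> A)
    (v : I -> R) (t z : R) :
  uniq r -> {in r &, injective key} ->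
  Pr (bern p) (fun w : {ffun A -> bool} =>
     t * z <= t * \sum_(i <- r) v i * (w (key i))%:R) <=
  expR (p * \sum_(i <- r) (expR (t * v i) - 1) - t * z).
Proof.
move=> ur kinj.
apply: le_trans (@Pr_markov _ _ _ _ bern_ge0 _
  (fun w => expR (- (t * z)) *
     \prod_(i <- r) expR (t * v i * (w (key i))%:R)) _ _) _.
- by move=> w; rewrite mulr_ge0 ?prodr_ge0 // ?expR_ge0 // => i _; rewrite expR_ge0.
- move=> w h; rewrite -expR_sum -expRD; apply: le_trans (expR_ge1Dx _).
  rewrite lerDl; move: h; rewrite mulr_sumr.
  under eq_bigr do rewrite mulrA.
  lra.
rewrite ExZ (Ex_prod_coord bern_sum (fun i (b : bool) => expR (t * v i * b%:R)) ur kinj).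
rewrite addrC expRD ler_wpM2l ?expR_ge0 // mulr_sumr expR_sum.
apply: ler_prod => i _; rewrite bern_mgf andbT.
by apply: sumr_ge0 => b _; rewrite mulr_ge0 ?bern_ge0 ?expR_ge0.
Qed.

Lemma card_tail (K : {set A}) (t z : R) :
  Pr (bern p) (fun w : {ffun A -> bool} =>
     t * z <= t * #|[set a in K | w a]|%:R) <=
  expR (p * (expR t - 1) * #|K|%:R - t * z).
Proof.
have := @weighted_tail _ (enum K) id (fun=> 1) t z (enum_uniq _) (fun _ _ _ _ h => h).
rewrite mulr1 big_const_seq count_predT iter_addr_0 -cardE -[_ *+ _]mulr_natr mulrA.
apply: le_trans; apply: Pr_sub => // [|w]; first exact: bern_ge0.
suff -> : \sum_(i <- enum K) 1 * (w i)%:R = #|[set a in K | w a]|%:R :> R by [].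
rewrite big_enum /= -sum1_card natr_sum big_mkcond [RHS]big_mkcond /=.
by apply: eq_bigr => a _; rewrite inE mul1r; case: (a \in K); case: (w a).
Qed.

(* Each factor has conditional expectation at most one given the coordinates of
   larger height. *)
Lemma predictable_mgf (ht : A -> nat) (X : A -> {ffun A -> bool} -> bool) (t : R)
    (s : seq A) :
  (forall e, depends_on (fun a => ht e < ht a)%N (X e)) ->
  uniq s -> sorted (fun a b => ht a <= ht b)%N s ->
  Ex (bern p) (fun w => \prod_(e <- s)
     (if X e w then expR (t * (w e)%:R - p * (expR t - 1)) else 1)) <= 1.
Proof.
move=> dX; elim: s => [|e s IH] /= => [_ _|/andP[es us] ps].
  rewrite (@Ex_ext _ _ _ _ _ (fun=> 1)) ?Ex_cst // ?bern_sum // => w.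
  by rewrite big_nil.
have tr : transitive (fun a b => ht a <= ht b)%N by move=> x y z; exact: leq_trans.
have le_e := order_path_min tr ps.
set Z := fun w : {ffun A -> bool} => \prod_(e' <- s) _ in IH *.
pose h (b : bool) := expR (t * b%:R - p * (expR t - 1)).
have dZ : depends_on (predC (pred1 e)) Z.
  move=> w w' ww'; apply: eq_big_seq => e' e's.
  have ee' : e' != e by apply: contraNneq es => <-.
  rewrite (ww' e') // (dX e' w w') // => a ha; apply: ww'.
  rewrite /=; apply: contraTneq ha => ->.
  by rewrite -leqNgt (allP le_e).
have dXe : depends_on (predC (pred1 e)) (X e).
  move=> w w' ww'; apply: dX => a ha; apply: ww'.
  by rewrite /=; apply: contraTneq ha => ->; rewrite ltnn.
rewrite (@Ex_ext _ _ _ _ _ (fun w => h (w e) * ((X e w)%:R * Z w) +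
    (~~ X e w)%:R * Z w)); last first.
  by move=> w; rewrite big_cons /h -/(Z w); case: (X e w); rewrite /= ?mul0r ?mulr0 ?addr0 ?add0r ?mul1r.
rewrite ExD (@Ex_indep _ _ _ _ bern_sum (pred1 e)); last 2 first.
- by move=> w w' ww'; rewrite ww' /=.
- by move=> w w' ww'; rewrite (dXe w w') // (dZ w w').
have h1 : Ex (bern p) (fun w : {ffun A -> bool} => h (w e)) <= 1.
  rewrite (Ex_coord bern_sum e h) /h.
  under eq_bigr do rewrite expRD mulrA.
  rewrite -mulr_suml -[leRHS](expRxMexpNx_1 (p * (expR t - 1))).
  by apply: ler_wpM2r (bern_mgf t); exact: expR_ge0.
have Z0 w : 0 <= Z w.
  by apply: prodr_ge0 => a _; case: ifP => // _; rewrite expR_ge0.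
apply: (@le_trans _ _ (1 * Ex (bern p) (fun w => (X e w)%:R * Z w) +
   Ex (bern p) (fun w => (~~ X e w)%:R * Z w))).
  rewrite lerD2r ler_wpM2r // Ex_ge0 //; first exact: bern_ge0.
  by move=> w; rewrite mulr_ge0 ?ler0n.
rewrite mul1r -ExD; apply: le_trans (IH us (path_sorted ps)).
apply: Ex_le => [|w]; first exact: bern_ge0.
by case: (X e w); rewrite /= ?mul0r ?addr0 ?add0r mul1r.
Qed.

(** Markov's inequality for an exponential supermartingale. When coordinates are revealed from the
    greatest height down, it is settled whether [e] counts before [w e] is seen; so the successes
    behave as in at most [c] trials, although the set of trials is random. *)
Lemma predictable_tail (ht : A -> nat) (X : A -> {ffun A -> bool} -> bool)
    (t c z : R) :
  0 <= t -> (forall e, depends_on (fun a => ht e < ht a)%N (X e)) ->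
  Pr (bern p) (fun w => (#|[set e | X e w]|%:R <= c) &&
                        (z <= #|[set e | X e w && w e]|%:R)) <=
  expR (p * (expR t - 1) * c - t * z).
Proof.
move=> t0 dX.
pose s := sort (fun a b => ht a <= ht b)%N (enum A).
have us : uniq s by rewrite sort_uniq enum_uniq.
have ss : sorted (fun a b => ht a <= ht b)%N s.
  by apply: sort_sorted => a b; exact: leq_total.
have /= mgf := predictable_mgf t dX us ss.
set C := expR _; rewrite -[C]mulr1; apply: le_trans (ler_wpM2l _ mgf); last exact: expR_ge0.
rewrite -ExZ; apply: Pr_markov => [||w /andP[hc hz]]; first exact: bern_ge0.
  move=> w; rewrite mulr_ge0 ?expR_ge0 ?prodr_ge0 // => e _.
  by case: ifP => // _; rewrite expR_ge0.
have -> : \prod_(e <- s) (if X e w then expR (t * (w e)%:R - p * (expR t - 1)) else 1)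
   = expR (t * #|[set e | X e w && w e]|%:R -
           p * (expR t - 1) * #|[set e | X e w]|%:R).
  rewrite (perm_big (enum A)) /=; last by rewrite perm_sort.
  rewrite big_enum /= -big_mkcondr /= -expR_sum; congr expR.
  rewrite big_split /= -mulr_sumr; congr (_ + _).
    congr (_ * _); rewrite -sum1_card natr_sum [RHS]big_mkcond [LHS]big_mkcond /=.
    by apply: eq_bigr => a _; rewrite inE; case: (X a w); case: (w a).
  rewrite sumr_const -[#|[set e | X e w]|]/(#|_|) mulr_natr -mulNrn; congr (_ *+ _).
  by apply: eq_card => a; rewrite !inE.
rewrite -expRD -[leLHS]expR0 ler_expR.
have et : 0 <= expR t - 1 by rewrite subr_ge0 -[leLHS]expR0 ler_expR.
have h1 : t * z <= t * #|[set e | X e w && w e]|%:R by rewrite ler_wpM2l.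
have h2 : p * (expR t - 1) * #|[set e | X e w]|%:R <= p * (expR t - 1) * c.
  by rewrite ler_wpM2l // mulr_ge0.
lra.
Qed.

End Tails.
End Bernoulli.

(** * Random graphs *)

(** An edge is stored at the ordered pair with its smaller end first, so each unordered pair owns
    one independent coordinate and the second component can serve as the height. *)
Definition key m (a b : 'I_m) : 'I_m * 'I_m := if (a < b)%N then (a, b) else (b, a).
Definition adj m (g : {ffun 'I_m * 'I_m -> bool}) (a b : 'I_m) :=
  (a != b) && g (key a b).

Lemma keyC m (a b : 'I_m) : key a b = key b a.
Proof. by rewrite /key; case: ltngtP => // /val_inj ->. Qed.

Lemma adjC m g (a b : 'I_m) : adj g a b = adj g b a.
Proof. by rewrite /adj eq_sym keyC. Qed.

Lemma key_inj m (a b c : 'I_m) : key a b = key a c -> b = c.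
Proof. by rewrite /key; case: ifP; case: ifP => _ _ [] // -> ->. Qed.

Lemma key_eq m (a b c d : 'I_m) : key a b = key c d ->
  (a = c /\ b = d) \/ (a = d /\ b = c).
Proof. by rewrite /key; case: ifP; case: ifP => _ _ [] -> ->; tauto. Qed.

Lemma key_max m (a b : 'I_m) : (key a b).2 = maxn a b :> nat.
Proof. by rewrite /key; case: ltnP => /=. Qed.

Section RandomGraph.
Variables (R : realType) (m : nat).
Implicit Types (g : {ffun 'I_m * 'I_m -> bool}) (J : {set 'I_m}) (v : 'I_m -> R).

(** With [v] counting labels per block, [wdeg] counts the labels adjacent to [b], and [wcod] the
    ordered pairs of labels in distinct blocks that have [b] as a common neighbour. *)
Definition wdeg g J v b : R := \sum_(a in J) v a * (adj g b a)%:R.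
Definition wcod g J v b : R :=
  \sum_(a in J) \sum_(c in J | c != a) v a * v c * (adj g b a && adj g b c)%:R.

Lemma wdeg_ge0 g J v b : (forall a, 0 <= v a) -> 0 <= wdeg g J v b.
Proof. by move=> v0; apply: sumr_ge0 => a _; rewrite mulr_ge0 ?ler0n. Qed.

Lemma wcod_ge0 g J v b : (forall a, 0 <= v a) -> 0 <= wcod g J v b.
Proof.
by move=> v0; apply: sumr_ge0 => a _; apply: sumr_ge0 => c _; rewrite !mulr_ge0 ?ler0n.
Qed.

Lemma wcod_le g J v b : (forall a, 0 <= v a) -> wcod g J v b <= wdeg g J v b ^+ 2.
Proof.
move=> v0; rewrite expr2 /wdeg mulr_suml; apply: ler_sum => a aJ.
rewrite mulr_sumr big_mkcondr /=; apply: ler_sum => c cJ.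
rewrite mulrACA -natrM mulnb; case: ifP => // _; rewrite !mulr_ge0 ?ler0n //.
Qed.

Variable p : R.
Hypotheses (p_ge0 : 0 <= p) (p_le1 : p <= 1).

Let Bge0 := bern_ge0 p_ge0 p_le1.
Let Bsum := bern_sum p.

(** The edges from [b] to [J] are independent. Under the exponential tilt each of the two prescribed
    edges costs at most p e^(1/2), and the remaining growth is a product of factors exp (2 p th v
    a). *)
Lemma cherry_mgf J v b a1 a2 (S kk th : R) :
  (forall a, 0 <= v a <= S) -> \sum_(a in J) v a <= kk -> 0 <= th ->
  th * S <= 2^-1 -> th * kk * p <= 2^-1 ->
  b \notin J -> a1 \in J -> a2 \in J -> a2 != a1 ->
  Ex (bern p) (fun g => (adj g b a1 && adj g b a2)%:R * expR (th * wdeg g J v b)) <=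
  16 * p ^+ 2.
Proof.
move=> vS vk th0 thS thk bJ a1J a2J a12.
have bne a : a \in J -> b != a by move=> aJ; apply: contraNneq bJ => ->.
pose sp (a : 'I_m) := (a == a1) || (a == a2).
pose h a (x : bool) : R := (if sp a then x%:R else 1) * expR (th * v a * x%:R).
rewrite (@Ex_ext _ _ _ _ _ (fun g => \prod_(a <- enum J) h a (g (key b a)))); last first.
  move=> g; rewrite big_enum /= big_split /= -expR_sum; congr (_ * expR _).
    rewrite /sp (bigD1 a1) //= eqxx (bigD1 a2) /=; last by rewrite a2J.
    rewrite eqxx orbT big1 ?mulr1; last by move=> a /andP[/andP[_ /negPf ->] /negPf ->].
    by rewrite /adj !bne //= -natrM mulnb.
  rewrite /wdeg mulr_sumr; apply: eq_bigr => a aJ.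
  by rewrite /adj bne // mulrA.
rewrite (Ex_prod_coord Bsum h) ?enum_uniq //; last first.
  by move=> a c _ _; exact: key_inj.
pose c a : R := if sp a then p * expR (2^-1) else 1.
apply: (@le_trans _ _ (\prod_(a in J) (c a * expR (2 * p * th * v a)))).
  rewrite big_enum /=; apply: ler_prod => a aJ; rewrite big_bool /h /=.
  have /andP[v0 vS'] := vS a.
  have tv0 : 0 <= th * v a by rewrite mulr_ge0.
  have tv2 : th * v a <= 2^-1 by apply: le_trans thS; rewrite ler_wpM2l.
  have e0 := expR_ge0 (th * v a).
  have q0 : 0 <= 1 - p by rewrite subr_ge0.
  have ptv : 0 <= p * (th * v a) by rewrite mulr_ge0.
  rewrite mulr0 expR0 !mulr1 /c; apply/andP; split.
    by case: (sp a); rewrite ?mul1r ?mulr0 ?addr0 ?addr_ge0 ?mulr_ge0.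
  case: (sp a); rewrite ?mul1r ?mulr0 ?addr0.
    rewrite -[leLHS]mulr1; apply: ler_pM => //; rewrite ?mulr_ge0 //.
      by rewrite ler_wpM2l // ler_expR.
    by rewrite -[leLHS]expR0 ler_expR -!mulrA mulr_ge0 // mulrA.
  have h1 := expR_le_lin tv0 tv2.
  apply: le_trans (expR_ge1Dx _).
  have : p * expR (th * v a) <= p * (1 + 2 * (th * v a)) by rewrite ler_wpM2l.
  lra.
rewrite big_split /= -expR_sum -mulr_sumr.
have -> : \prod_(a in J) c a = (p * expR (2^-1)) ^+ 2.
  rewrite /c /sp (bigD1 a1) //= eqxx (bigD1 a2) /=; last by rewrite a2J.
  by rewrite eqxx orbT big1 ?mulr1 // => a /andP[/andP[_ /negPf ->] /negPf ->].
rewrite exprMn -mulrA [leRHS]mulrC ler_wpM2l ?sqr_ge0 //.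
(* One factor e comes from the two prescribed edges, the other from 2 p th kk <= 1; each is bounded
   by 4. *)
have -> : 16 = 4 * 4 :> R by lra.
have e1 : expR (2 * p * th * \sum_(a in J) v a) <= 4.
  apply: le_trans (expR1_le4 R); rewrite ler_expR.
  have : p * th * \sum_(a in J) v a <= p * th * kk by rewrite ler_wpM2l // mulr_ge0.
  lra.
apply: ler_pM; rewrite ?expR_ge0 ?sqr_ge0 //.
rewrite -expRM_natl; apply: le_trans (expR1_le4 R); rewrite ler_expR; lra.
Qed.

(** For light [b] the codegree weight is at most [D] times the degree weight, so exp (lam wcod) <= 1
    + lam wcod exp (lam D wdeg). The right side is linear in the cherries, with mean controlled by
    [cherry_mgf], and these factors are independent over [b] outside [J]. *)
Lemma light_outer_tail J v (S kk D lam z : R) :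
  (forall a, 0 <= v a <= S) -> \sum_(a in J) v a <= kk -> 0 <= lam -> 0 <= D ->
  lam * D * S <= 2^-1 -> lam * D * kk * p <= 2^-1 ->
  Pr (bern p) (fun g => z <= \sum_(b | (b \notin J) && (wdeg g J v b <= D)) wcod g J v b) <=
  expR (lam * (m%:R * (16 * (kk * p) ^+ 2) - z)).
Proof.
move=> vS vk lam0 D0 lDS lDk.
have v0 a : 0 <= v a by have /andP[] := vS a.
have lD0 : 0 <= lam * D by rewrite mulr_ge0.
pose F b g := 1 + lam * (wcod g J v b * expR (lam * D * wdeg g J v b)).
have F0 b g : 0 <= F b g.
  by rewrite /F addr_ge0 ?mulr_ge0 ?wcod_ge0 ?expR_ge0.
have le1 g : expR (lam * \sum_(b | (b \notin J) && (wdeg g J v b <= D)) wcod g J v b)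
    <= \prod_(b <- enum (~: J)) F b g.
  rewrite mulr_sumr expR_sum big_enum_cond /=.
  under [leRHS]eq_bigl do rewrite in_setC andbT.
  rewrite big_mkcondr /=; apply: ler_prod => b bJ.
  have q0 := wcod_ge0 g J b v0.
  case: ifP => hD; last first.
    by rewrite ler01 /F lerDl ?mulr_ge0 ?expR_ge0.
  rewrite expR_ge0 /=; set z1 := lam * wcod g J v b.
  have z10 : 0 <= z1 by rewrite mulr_ge0.
  have h1 : expR z1 <= 1 + z1 * expR z1.
    have := expR_ge1Dx (- z1); rewrite -(ler_pM2l (expR_gt0 z1)) expRxMexpNx_1; lra.
  apply: (le_trans h1); rewrite /F mulrA -/z1 lerD2l ler_wpM2l // ler_expR.
  rewrite /z1 -mulrA ler_wpM2l //; apply: le_trans (wcod_le _ _ _ v0) _.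
  by rewrite expr2 ler_wpM2r // wdeg_ge0.
apply: (@le_trans _ _ (expR (- (lam * z)) * Ex (bern p) (fun g => \prod_(b <- enum (~: J)) F b g))).
  rewrite -ExZ; apply: Pr_markov => [||g hz]; first exact: Bge0.
    by move=> g; rewrite mulr_ge0 ?expR_ge0 ?prodr_ge0.
  apply: le_trans (ler_wpM2l (expR_ge0 _) (le1 g)).
  by rewrite -expRD -[leLHS]expR0 ler_expR addrC subr_ge0 ler_wpM2l.
(* Stars from distinct centres outside [J] into [J] share no edge. *)
rewrite (@Ex_prod_indep _ _ _ _ Bsum _ _ (fun b => [pred e | [exists a in J, e == key b a]]));
  first 1 last.
- exact: enum_uniq.
- move=> b; rewrite mem_enum in_setC => bJ g g' gg'.
  have eqadj a : a \in J -> adj g b a = adj g' b a.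
    move=> aJ; rewrite /adj gg' //=; apply/existsP; exists a.
    by rewrite aJ eqxx.
  rewrite /F (_ : wdeg g J v b = wdeg g' J v b); last first.
    by apply: eq_bigr => a aJ; rewrite eqadj.
  congr (_ + _ * (_ * _)); apply: eq_bigr => a aJ.
  by apply: eq_bigr => c /andP[cJ _]; rewrite !eqadj.
- move=> b b' e; rewrite !mem_enum !in_setC => bJ b'J /=.
  case/existsP=> a /andP[aJ /eqP ->] /existsP[a' /andP[a'J /eqP/key_eq]].
  by case=> [[]|[ba' _]] //; rewrite ba' a'J in bJ.
have -> : lam * (m%:R * (16 * (kk * p) ^+ 2) - z) =
    - (lam * z) + lam * (16 * (kk * p) ^+ 2) * m%:R by ring.
rewrite expRD ler_wpM2l ?expR_ge0 //.
apply: (@le_trans _ _ (\prod_(b <- enum (~: J)) expR (lam * (16 * (kk * p) ^+ 2)))).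
  rewrite !big_enum /=; apply: ler_prod => b; rewrite in_setC => bJ.
  rewrite (Ex_ge0 Bge0) //=.
  rewrite /F ExD ExZ (Ex_cst _ Bsum); apply: le_trans (expR_ge1Dx _).
  rewrite lerD2l ler_wpM2l //.
  rewrite (@Ex_ext _ _ _ _ _ (fun g => \sum_(a in J) \sum_(c in J | c != a)
     v a * v c * ((adj g b a && adj g b c)%:R * expR (lam * D * wdeg g J v b)))); last first.
    move=> g; rewrite mulr_suml; apply: eq_bigr => a _; rewrite mulr_suml.
    by apply: eq_bigr => c _; rewrite mulrA.
  rewrite Ex_sum.
  apply: (@le_trans _ _ (\sum_(a in J) \sum_(c in J) v a * v c * (16 * p ^+ 2))).
    apply: ler_sum => a aJ; rewrite Ex_sum big_mkcondr /=; apply: ler_sum => c cJ.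
    case: ifP => ca; last by rewrite !mulr_ge0 ?sqr_ge0.
    rewrite ExZ ler_wpM2l ?mulr_ge0 //.
    by apply: (@cherry_mgf _ _ _ _ _ S kk).
  under eq_bigr do rewrite -mulr_suml -mulr_sumr.
  rewrite -mulr_suml -mulr_suml mulrCA exprMn ler_pM2l // ler_wpM2r ?sqr_ge0 //.
  have s0 : 0 <= \sum_(a in J) v a by apply: sumr_ge0.
  by rewrite expr2 ler_pM.
rewrite big_const_seq count_predT iter_mulr_1 -expRM_natr ler_expR ler_wpM2l //.
  by rewrite mulr_ge0 // mulr_ge0 // sqr_ge0.
by rewrite ler_nat -cardE -[leqRHS]card_ord max_card.
Qed.

End RandomGraph.

(** * Neighbourhoods, codegrees and pairs inside a vertex set *)

Section Pairs.
Variables (R : realType) (m : nat).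
Implicit Types (g : {ffun 'I_m * 'I_m -> bool}) (J : {set 'I_m}).

Definition nbr g b := [set a | adj g b a].
Definition codeg g b c := #|nbr g b :&: nbr g c|.

Lemma wdeg1 g b : wdeg g setT (fun=> 1 : R) b = #|nbr g b|%:R.
Proof.
rewrite /wdeg -sum1_card natr_sum [RHS]big_mkcond [LHS]big_mkcond /=.
by apply: eq_bigr => a _; rewrite !inE mul1r; case: adj.
Qed.

Definition pairs J : {set 'I_m * 'I_m} :=
  [set e | [&& e.1 \in J, e.2 \in J & (e.1 < e.2)%N]].

(** The square of [J] splits into increasing, decreasing and diagonal pairs; the doubled form stays
    in the natural numbers without division or subtraction. *)
Lemma card_pairs J : (#|pairs J|.*2 + #|J| = #|J| ^ 2)%N.
Proof.
pose P2 : {set 'I_m * 'I_m} := [set e | [&& e.1 \in J, e.2 \in J & (e.2 < e.1)%N]].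
pose P3 : {set 'I_m * 'I_m} := [set e | [&& e.1 \in J, e.2 \in J & e.2 == e.1]].
have c2 : #|P2| = #|pairs J|.
  pose sw (e : 'I_m * 'I_m) := (e.2, e.1).
  have swK : involutive sw by case.
  rewrite -(card_imset _ (inv_inj swK)); apply: eq_card => e.
  apply/imsetP/idP => [[[a b]]|]; rewrite !inE => /and3P[aJ bJ ab].
    by move=> ->; rewrite /= bJ aJ.
  by exists (sw e); rewrite ?swK // !inE /= bJ aJ.
have c3 : #|P3| = #|J|.
  have di : injective (fun a : 'I_m => (a, a)) by move=> a b [].
  rewrite -(card_imset _ di); apply: eq_card => -[a b].
  apply/idP/imsetP => [|[c cJ [-> ->]]]; rewrite !inE /= ?cJ ?eqxx //.
  by case/and3P=> aJ _ /eqP ->; exists a.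
have -> : (#|J| ^ 2 = #|setX J J|)%N by rewrite cardsX mulnn.
have -> : setX J J = (pairs J :|: P2) :|: P3.
  apply/setP => -[a b]; rewrite !inE /= -!andb_orr; case: (a \in J) => //=.
  case: (b \in J) => //=; rewrite -!val_eqE /=; lia.
rewrite cardsU (_ : _ :&: P3 = set0); last first.
  apply/setP => -[a b]; rewrite !inE /= -val_eqE /=; lia.
rewrite cardsU (_ : _ :&: P2 = set0); last first.
  apply/setP => -[a b]; rewrite !inE /=; lia.
by rewrite !cards0 !subn0 c2 c3 addnn.
Qed.

Lemma card_pairsE J : #|pairs J|%:R = (#|J|%:R ^+ 2 - #|J|%:R) / 2 :> R.
Proof.
have /(congr1 (fun x : nat => x%:R : R)) := card_pairs J.
rewrite natrD natrX -muln2 natrM; lra.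
Qed.

Lemma sum_adj g J :
  \sum_(b in J) \sum_(a in J) (adj g b a)%:R = 2 * #|[set e in pairs J | g e]|%:R :> R.
Proof.
rewrite mulr_natl mulr2n -sum1_card natr_sum.
rewrite (eq_bigl (fun e => (e \in pairs J) && g e)); last by move=> e; rewrite !inE.
rewrite pair_big /= (bigID (fun e : 'I_m * 'I_m => e.1 < e.2)%N) /=; congr (_ + _).
  rewrite [LHS]big_mkcond [RHS]big_mkcond /=; apply: eq_bigr => -[a b] _ /=.
  rewrite !inE /= /adj /key -val_eqE /=.
  by case: (a \in J) => //=; case: (b \in J) => //=; case: ltngtP => //= _; case: (g _).
rewrite (reindex_inj (inv_inj (_ : involutive (fun e : 'I_m * 'I_m => (e.2, e.1))))); last by case.
rewrite /= [LHS]big_mkcond [RHS]big_mkcond /=; apply: eq_bigr => -[a b] _ /=.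
rewrite !inE /= adjC /adj /key -val_eqE /=.
by case: (a \in J) => //=; case: (b \in J) => //=; case: ltngtP => //= _; case: (g _).
Qed.

End Pairs.

(** * Tails for degrees, codegrees and edge counts *)

Section Degrees.
Variables (R : realType) (m : nat) (p : R).
Hypotheses (p_ge0 : 0 <= p) (p_le1 : p <= 1).
Implicit Types (g : {ffun 'I_m * 'I_m -> bool}) (J : {set 'I_m}) (v : 'I_m -> R).

Let Bge0 := bern_ge0 p_ge0 p_le1.
Let Bsum := bern_sum p.

Lemma wdeg_tail v b (t z : R) : 0 < t -> (forall a, 0 <= v a) ->
  Pr (bern p) (fun g => z <= wdeg g setT v b) <=
  expR (p * \sum_a (expR (t * v a) - 1) - t * z).
Proof.
move=> t0 v0.
have kinj : {in [seq a <- enum 'I_m | a != b] &, injective (key b)}.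
  by move=> a c _ _; exact: key_inj.
apply: (@le_trans _ _ (Pr (bern p) (fun g : {ffun _ -> bool} => t * z <=
    t * \sum_(a <- [seq a <- enum 'I_m | a != b]) v a * (g (key b a))%:R))).
  apply: Pr_sub => // g hz; rewrite ler_pM2l //; apply: (le_trans hz).
  rewrite /wdeg big_filter big_enum_cond /= [leLHS]big_mkcond [leRHS]big_mkcond.
  rewrite le_eqVlt; apply/orP; left; apply/eqP; apply: eq_bigr => a _.
  by rewrite inE /adj eq_sym; case: eqP => //=; rewrite mulr0.
apply: le_trans (weighted_tail p_ge0 p_le1 v t z _ kinj) _.
  by rewrite filter_uniq ?enum_uniq.
rewrite ler_expR lerD2r ler_wpM2l // big_filter big_enum_cond /= [leLHS]big_mkcond.
apply: ler_sum => a _; case: ifP => // _.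
by rewrite subr_ge0 -[leLHS]expR0 ler_expR mulr_ge0 // ltW.
Qed.

Lemma deg_tail b (z : R) :
  Pr (bern p) (fun g => z <= #|nbr g b|%:R) <= expR (3 * p * m%:R - z).
Proof.
apply: (@le_trans _ _ (Pr (bern p) (fun g => z <= wdeg g setT (fun=> 1 : R) b))).
  by apply: Pr_sub => // g; rewrite wdeg1.
apply: le_trans (wdeg_tail _ _ ltr01 _) _; first by move=> _; exact: ler01.
rewrite ler_expR mulr1 mul1r sumr_const card_ord -[(expR 1 - 1) *+ m]mulr_natr.
rewrite mulrA lerD2r.
rewrite ler_wpM2r // mulrC ler_wpM2r //.
have := expR1_le4 R; lra.
Qed.

(** For a third vertex [a] the two edges to [b] and [c] use coordinates shared with no other [a], so
    the codegree is a sum of independent variables of mean p^2. *)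
Lemma codeg_tail b c (z : R) : b != c ->
  Pr (bern p) (fun g => z <= (codeg g b c)%:R) <= expR (3 * p ^+ 2 * m%:R - z).
Proof.
move=> bc.
pose r := enum [pred a | (a != b) && (a != c)].
pose F (a : 'I_m) g := expR ((g (key b a) && g (key c a))%:R : R).
apply: (@le_trans _ _ (expR (- z) * Ex (bern p) (fun g => \prod_(a <- r) F a g))).
  rewrite -ExZ; apply: Pr_markov => // [g|g hz].
    by rewrite mulr_ge0 ?expR_ge0 ?prodr_ge0 // => a _; rewrite expR_ge0.
  rewrite /F -expR_sum -expRD -[leLHS]expR0 ler_expR addrC subr_ge0.
  apply: (le_trans hz); rewrite /codeg -sum1_card natr_sum big_enum /=.
  rewrite [leLHS]big_mkcond [leRHS]big_mkcond /=; apply: ler_sum => a _.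
  rewrite !inE /adj eq_sym [c == a]eq_sym.
  by case: (a == b); case: (a == c) => //=; case: (g (key b a)); case: (g _).
rewrite (@Ex_prod_indep _ _ _ _ Bsum _ _ (fun a => pred2 (key b a) (key c a))); first 1 last.
- exact: enum_uniq.
- by move=> a _ g g' gg'; rewrite /F !gg' //= eqxx ?orbT.
- move=> a a' e; rewrite !mem_enum !inE => /andP[ab ac] /andP[a'b a'c].
  case/orP=> /eqP -> /orP[] /eqP.
  + exact: key_inj.
  + case/key_eq=> [[bc' _]|[ba' _]]; first by rewrite bc' eqxx in bc.
    by rewrite ba' eqxx in a'b.
  + case/key_eq=> [[cb' _]|[ca' _]]; first by rewrite cb' eqxx in bc.
    by rewrite ca' eqxx in a'c.
  + exact: key_inj.
rewrite addrC expRD ler_wpM2l ?expR_ge0 //.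
apply: (@le_trans _ _ (\prod_(a <- r) expR (3 * p ^+ 2))).
  rewrite !big_enum /=; apply: ler_prod => a /andP[ab ac].
  rewrite (Ex_ge0 Bge0) /= => [|g]; last exact: expR_ge0.
  have kne : key b a != key c a.
    apply/eqP => /key_eq[[bc' _]|[ba' _]]; first by rewrite bc' eqxx in bc.
    by rewrite ba' eqxx in ab.
  rewrite (@Ex_ext _ _ _ _ _ (fun g => 1 + (expR 1 - 1) *
     ((g (key b a))%:R * (g (key c a))%:R))); last first.
    by move=> g; rewrite /F; case: (g _); case: (g _); rewrite /= ?expR0 ?mulr0 ?mul0r ?mulr1; lra.
  rewrite ExD ExZ (Ex_cst _ Bsum) (@Ex_indep _ _ _ _ Bsum (pred1 (key b a))); last 2 first.
  - by move=> g g' gg'; rewrite gg' /=.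
  - by move=> g g' gg'; rewrite gg' //= eq_sym.
  rewrite !(Ex_coord Bsum _ (fun x : bool => x%:R)) !big_bool /= !mulr0 !mulr1 !addr0.
  apply: le_trans (expR_ge1Dx _); rewrite lerD2l expr2 ler_wpM2r ?mulr_ge0 //.
  have := expR1_le4 R; lra.
rewrite big_const_seq count_predT iter_mulr_1 -expRM_natr ler_expR ler_wpM2l //.
  by rewrite mulr_ge0 // sqr_ge0.
by rewrite ler_nat -cardE -[leqRHS]card_ord max_card.
Qed.

Lemma edges_tail J (z : R) :
  Pr (bern p) (fun g => z <= #|[set e in pairs J | g e]|%:R) <=
  expR (3 / 2 * p * #|J|%:R ^+ 2 - z).
Proof.
have := card_tail p_ge0 p_le1 (pairs J) 1 z.
have sub : Pr (bern p) (fun g => z <= #|[set e in pairs J | g e]|%:R) <=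
    Pr (bern p) (fun g : {ffun _ -> bool} => 1 * z <= 1 * #|[set e in pairs J | g e]|%:R).
  by apply: Pr_sub => // g; rewrite !mul1r.
move/(le_trans sub)/le_trans; apply; rewrite mul1r ler_expR lerD2r card_pairsE.
have h1 : expR 1 - 1 <= 3 :> R by have := expR1_le4 R; lra.
have h0 : 0 <= expR 1 - 1 :> R by rewrite subr_ge0 -[leLHS]expR0 ler_expR.
have j0 : 0 <= #|J|%:R :> R by [].
have j2 : 0 <= #|J|%:R ^+ 2 - #|J|%:R :> R.
  by rewrite subr_ge0 -natrX ler_nat; case: #|J| => // j; rewrite expnS expn1 leq_pmulr.
have : p * (expR 1 - 1) * (#|J|%:R ^+ 2 - #|J|%:R) <= p * 3 * (#|J|%:R ^+ 2 - #|J|%:R).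
  by rewrite ler_wpM2r // ler_wpM2l.
have := mulr_ge0 p_ge0 j0; lra.
Qed.

End Degrees.

(** * Pairs with a common neighbour *)

Section Labels.
Variables (R : realType) (m : nat).
Implicit Types (g h : {ffun 'I_m * 'I_m -> bool}) (J : {set 'I_m}) (be : 'I_m -> 'I_m).

Definition ldeg J be h b := #|[set a in J | adj h b (be a)]|.
Definition lpairs J be h b : {set 'I_m * 'I_m} :=
  [set e in setX J J | [&& be e.1 != be e.2, adj h b (be e.1) & adj h b (be e.2)]].
Definition mult J be b : R := #|[set a in J | be a == b]|%:R.

Lemma sum_mult J be J' (F : 'I_m -> R) : (forall a, a \in J -> be a \in J') ->
  \sum_(b in J') mult J be b * F b = \sum_(a in J) F (be a).
Proof.
move=> bJ; rewrite [RHS](partition_big be (mem J')) //=; apply: eq_bigr => b _.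
rewrite (eq_bigr (fun=> F b)); last by move=> a /andP[_ /eqP ->].
rewrite sumr_const mulr_natl; congr (_ *+ _).
by apply: eq_card => a; rewrite !inE.
Qed.

Lemma wdeg_mult J be J' h b : (forall a, a \in J -> be a \in J') ->
  wdeg h J' (mult J be) b = (ldeg J be h b)%:R.
Proof.
move=> bJ; rewrite /wdeg sum_mult // /ldeg -sum1_card natr_sum.
rewrite [LHS]big_mkcond [RHS]big_mkcond /=; apply: eq_bigr => a _.
by rewrite inE; case: (a \in J); case: adj.
Qed.

Lemma wcod_mult J be J' h b : (forall a, a \in J -> be a \in J') ->
  wcod h J' (mult J be) b = #|lpairs J be h b|%:R.
Proof.
move=> bJ; rewrite /wcod.
transitivity (\sum_(b1 in J') mult J be b1 * \sum_(b2 in J') mult J be b2 *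
    [&& b1 != b2, adj h b b1 & adj h b b2]%:R).
  apply: eq_bigr => b1 _; rewrite mulr_sumr big_mkcondr /=; apply: eq_bigr => b2 _.
  by rewrite mulrA eq_sym; case: ifP => //= _; rewrite mulr0.
rewrite sum_mult //; under eq_bigr do rewrite sum_mult //.
rewrite -sum1_card natr_sum pair_big /= [LHS]big_mkcond [RHS]big_mkcond /=.
apply: eq_bigr => -[a c] _; rewrite !inE /=.
by case: (a \in J) => //=; case: (c \in J) => //=; case: [&& _, _ & _].
Qed.

Lemma mult_ge0 J be b : 0 <= mult J be b.
Proof. exact: ler0n. Qed.

Lemma light_tail J be J' (p S kk D lam z : R) :
  0 <= p -> p <= 1 -> (forall a, a \in J -> be a \in J') ->
  (forall b, mult J be b <= S) -> #|J|%:R <= kk -> 0 <= lam -> 0 <= D ->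
  lam * D * S <= 2^-1 -> lam * D * kk * p <= 2^-1 ->
  Pr (bern p) (fun h => z <= \sum_(b | (b \notin J') && ((ldeg J be h b)%:R <= D))
                       #|lpairs J be h b|%:R) <=
  expR (lam * (m%:R * (16 * (kk * p) ^+ 2) - z)).
Proof.
move=> p0 p1 bJ mS Jk lam0 D0 h1 h2.
have := @light_outer_tail R m p p0 p1 J' (mult J be) S kk D lam z _ _ lam0 D0 h1 h2.
move=> H; apply: le_trans (H _ _); last 2 first.
- by move=> a; rewrite mult_ge0 mS.
- have := @sum_mult J be J' (fun=> 1) bJ; rewrite sumr_const.
  by under eq_bigr do rewrite mulr1; move=> ->.
apply: Pr_sub => [|h]; first exact: bern_ge0.
congr (_ <= _ : Prop); rewrite (eq_bigl (fun b => (b \notin J') && (wdeg h J' (mult J be) b <= D))).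
  by apply: eq_bigr => b _; rewrite wcod_mult.
by move=> b; rewrite wdeg_mult.
Qed.

(** Adds the light blocks inside [J'] to the outer ones. Such a block closes at most [D] times its
    weighted degree many pairs, and the weighted degrees inside [J'] sum to at most [S] times twice
    the number of edges there. *)
Lemma light_sum J be J' h (S D y z : R) :
  (forall a, a \in J -> be a \in J') -> (forall b, mult J be b <= S) -> 0 <= D -> 0 <= S ->
  \sum_(b | (b \notin J') && ((ldeg J be h b)%:R <= D)) #|lpairs J be h b|%:R <= z ->
  #|[set e in pairs J' | h e]|%:R <= y ->
  \sum_(b | (ldeg J be h b)%:R <= D) #|lpairs J be h b|%:R <= z + 2 * D * S * y.
Proof.
move=> bJ mS D0 S0 hz hy; rewrite (bigID (mem J')) /= addrC lerD //.
  by under eq_bigl do rewrite andbC.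
apply: (@le_trans _ _ (\sum_(b in J') D * wdeg h J' (mult J be) b)).
  rewrite [leRHS]big_mkcond [leLHS]big_mkcond /=; apply: ler_sum => b _.
  case: (b \in J'); rewrite ?andbT ?andbF //.
  have w0 := wdeg_ge0 h J' b (mult_ge0 J be).
  case: ifP => [hD|_]; last by rewrite mulr_ge0.
  rewrite -(wcod_mult _ _ bJ); apply: le_trans (wcod_le _ _ _ (mult_ge0 J be)) _.
  by rewrite expr2 ler_wpM2r // wdeg_mult.
rewrite -mulr_sumr.
have -> : 2 * D * S * y = D * (S * (2 * y)) by ring.
rewrite ler_wpM2l //.
apply: (@le_trans _ _ (S * (\sum_(b in J') \sum_(a in J') (adj h b a)%:R))).
  rewrite mulr_sumr; apply: ler_sum => b _; rewrite mulr_sumr; apply: ler_sum => a _.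
  by rewrite ler_wpM2r.
by rewrite sum_adj ler_wpM2l // ler_wpM2l.
Qed.

(** A point lying in q >= 1 of the sets counts q on the left and 1 + q (q - 1) on the right. *)
Lemma bonferroni (I T : finType) (F : I -> {set T}) (K : {set I}) :
  (\sum_(i in K) #|F i| <= #|\bigcup_(i in K) F i| +
     \sum_(i in K) \sum_(j in K | j != i) #|F i :&: F j|)%N.
Proof.
have cE (B : {set T}) : #|B| = (\sum_x (x \in B))%N.
  by rewrite -sum1_card big_mkcond /=; apply: eq_bigr => x _; case: (x \in B).
rewrite cE (eq_bigr (fun i => \sum_x (x \in F i))%N); last by move=> i _; exact: cE.
rewrite exchange_big /=.
under [X in (_ <= _ + X)%N]eq_bigr => i _.
  under eq_bigr do rewrite cE.
  rewrite exchange_big /=. over.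
rewrite [X in (_ <= _ + X)%N]exchange_big /= -big_split /=; apply: leq_sum => x _.
case: (boolP (x \in \bigcup_(i in K) F i)) => [/bigcupP[i iK xi]|xn]; last first.
  rewrite big1 // => i iK; apply/eqP; rewrite eqb0; apply: contra xn => xi.
  by apply/bigcupP; exists i.
(* One set [F i] containing [x] is paid by the union; the row of [i] in the double sum already pays
   for all others. *)
rewrite (bigD1 i) //= xi leq_add2l (bigD1 i iK) /=; apply: leq_trans (leq_addr _ _).
by apply: leq_sum => j _; rewrite inE xi.
Qed.

End Labels.

Lemma card_bigcup_le (I T : finType) (P : pred I) (F : I -> {set T}) :
  (#|\bigcup_(i | P i) F i| <= \sum_(i | P i) #|F i|)%N.
Proof.
elim/big_rec2: _ => [|i n B _ IH]; first by rewrite cards0.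
by apply: leq_trans (leq_card_setU _ _) _; rewrite leq_add2l.
Qed.

(** Every such set is the range of a [d]-tuple over the [m] points and one padding value. *)
Lemma card_small_sets m d :
  (#|[set B : {set 'I_m} | #|B| <= d]| <= m.+1 ^ d)%N.
Proof.
pose im (f : {ffun 'I_d -> option 'I_m}) := [set x | [exists i, f i == Some x]].
have -> : (m.+1 ^ d = #|{ffun 'I_d -> option 'I_m}|)%N.
  by rewrite card_ffun card_option !card_ord.
apply: leq_trans (leq_imset_card im predT); apply: subset_leq_card.
apply/subsetP => B; rewrite inE => Bd; apply/imsetP.
exists [ffun i : 'I_d => onth (enum B) i] => //; apply/setP => x; rewrite inE.
apply/idP/existsP => [xB|[i]].
  have ix : (index x (enum B) < d)%N.
    by apply: leq_trans Bd; rewrite cardE index_mem mem_enum.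
  exists (Ordinal ix); rewrite ffunE /= onthE (nth_map x) ?nth_index ?mem_enum //.
  by rewrite index_mem mem_enum.
rewrite ffunE onthE; case: (ltnP i (size (enum B))) => hi.
  by rewrite (nth_map x) // => /eqP[<-]; rewrite -mem_enum mem_nth.
by rewrite nth_default // size_map.
Qed.

(** * Lightly closed pairs and heavy neighbourhoods *)

Section Side.
Variables (R : realType) (m : nat).
Implicit Types (g h : {ffun 'I_m * 'I_m -> bool}) (J : {set 'I_m}) (be : 'I_m -> 'I_m).

(** The two reasons for deleting an edge, read off on blocks; since [e.1 < e.2] in use, [c] lies
    above both ends. *)
Definition edge_closed be g h (e : 'I_m * 'I_m) :=
  [exists b, adj h b (be e.1) && adj h b (be e.2)] ||
  [exists c : 'I_m, [&& (e.2 < c)%N, adj g c e.1 & adj g c e.2]].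

(** Heavy neighbourhoods are left out so that, once [h] is fixed, few pairs qualify; pairs with
    equal labels are put on this side as well. *)
Definition lightly_closed J be (th : R) h e g :=
  (e \in pairs J) &&
  [|| be e.1 == be e.2,
      [exists b, [&& (ldeg J be h b)%:R <= th, adj h b (be e.1) & adj h b (be e.2)]] |
      [exists c : 'I_m, [&& (e.2 < c)%N, adj g c e.1 & adj g c e.2]]].

(** [A] stands for the heavy neighbourhoods, but as a free parameter: nothing here refers to a
    graph. *)
Definition covered J be t (A : {ffun 'I_t -> {set 'I_m}}) :=
  [set e in pairs J | [exists i, (be e.1 \in A i) && (be e.2 \in A i)]].

(** Only edges of [g] at some [c] above [e.2] matter, and the larger end of such an edge is at least
    [c]. This is what the deletion rule with a larger block is for. *)
Lemma lightly_closed_predictable J be th h (e : 'I_m * 'I_m) :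
  depends_on (fun a : 'I_m * 'I_m => (e.2 : nat) < a.2)%N (lightly_closed J be th h e).
Proof.
move=> g g' gg'; rewrite /lightly_closed; congr (_ && (_ || (_ || _))).
apply: eq_existsb => c; case: ltnP => //= ec.
by rewrite /adj !gg' // key_max leq_max ec.
Qed.

Section Deterministic.
Variables (J J' : {set 'I_m}) (be : 'I_m -> 'I_m) (g h : {ffun 'I_m * 'I_m -> bool}).
Variables (k S d r t0 t1 : nat) (D th xk y z1 z2 : R).
Hypothesis beJ : forall a, a \in J -> be a \in J'.
Hypothesis Jk : (#|J| <= k)%N.
Hypothesis mulS : forall b, (#|[set a in J | be a == b]| <= S)%N.
Hypothesis HN : forall N : {set 'I_m},
  (#|[set a in J | be a \in N]| + #|J'| <= k + #|N|)%N.
Hypothesis hdeg : forall b, (#|nbr h b| <= d)%N.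
Hypothesis gdeg : forall b, (#|nbr g b| <= d)%N.
Hypothesis hcod : forall b c, b != c -> (codeg h b c <= r)%N.
Hypothesis hx : forall b, (ldeg J be h b)%:R <= xk.
Hypothesis xk0 : 0 <= xk.
Hypothesis D0 : 0 <= D.
Hypothesis Dth : D <= th.
Hypothesis t1P : k%:R + (t1 ^ 2 * (r * S))%:R <= t1%:R * D :> R.
Hypothesis t0P : k%:R + (t1 ^ 2 * (r * S))%:R <= t0%:R * th :> R.
Hypothesis k0 : (0 < k)%N.
Hypothesis z1P : \sum_(b | (b \notin J') && ((ldeg J be h b)%:R <= D))
                    #|lpairs J be h b|%:R <= z1.
Hypothesis y1P : #|[set e in pairs J' | h e]|%:R <= y.
Hypothesis z2P : \sum_(b | (b \notin J) && ((ldeg J id g b)%:R <= d%:R :> R))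
                    #|lpairs J id g b|%:R <= z2.
Hypothesis y2P : #|[set e in pairs J | g e]|%:R <= y.

Let nb b := [set a in J | adj h b (be a)].

Lemma nb_cap b c : b != c -> (#|nb b :&: nb c| <= r * S)%N.
Proof.
move=> bc.
apply: (@leq_trans #|\bigcup_(x in nbr h b :&: nbr h c) [set a in J | be a == x]|).
  apply: subset_leq_card; apply/subsetP => a; rewrite !inE.
  case/andP=> /andP[aJ ab] /andP[_ ac].
  by apply/bigcupP; exists (be a); rewrite !inE ?ab ?ac ?aJ ?eqxx.
apply: leq_trans (card_bigcup_le _ _) _.
apply: (@leq_trans (\sum_(x in nbr h b :&: nbr h c) S)); first by apply: leq_sum.
by rewrite sum_nat_const leq_mul2r hcod ?orbT.
Qed.

Lemma ldeg_sum (T : {set 'I_m}) :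
  (\sum_(b in T) ldeg J be h b <= #|\bigcup_(b in T) nb b| + #|T| ^ 2 * (r * S))%N.
Proof.
apply: leq_trans (bonferroni nb T) _; rewrite leq_add2l.
apply: (@leq_trans (\sum_(i in T) \sum_(j in T) r * S)).
  apply: leq_sum => i iT; rewrite big_mkcondr /=; apply: leq_sum => j jT.
  by case: ifP => // ji; rewrite nb_cap // eq_sym.
by rewrite !sum_nat_const -mulnn mulnA.
Qed.

Lemma bigcup_nb_le (T : {set 'I_m}) : (#|\bigcup_(b in T) nb b| <= k)%N.
Proof.
apply: leq_trans Jk; apply: subset_leq_card; apply/subsetP => a.
by case/bigcupP=> b _; rewrite inE => /andP[].
Qed.

Let big_b := [set b | D < (ldeg J be h b)%:R].

(** More than [t1] such neighbourhoods would overlap too little to fit into [k] labels, by [t1P] and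
    Bonferroni. *)
Lemma card_big_b : (#|big_b| <= t1)%N.
Proof.
rewrite leqNgt; apply/negP => lt.
(* Exactly [t1] of them are taken, so that the overlap term is t1^2 times the codegree bound. *)
pose T := [set b in take t1 (enum big_b)].
have cT : #|T| = t1.
  rewrite cardsE (card_uniqP _) ?take_uniq ?enum_uniq // size_takel //.
  by rewrite -cardE ltnW.
have sT b : b \in T -> D < (ldeg J be h b)%:R.
  by rewrite inE => /mem_take; rewrite mem_enum inE.
have t1_gt0 : (0 < t1)%N.
  rewrite lt0n; apply/eqP => t10; move: t1P; rewrite t10 mul0r mul0n addr0.
  by rewrite lern0 eqn0Ngt k0.
have [b0 b0T] : exists b, b \in T by apply/card_gt0P; rewrite cT.
have : t1%:R * D < \sum_(b in T) (ldeg J be h b)%:R.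
  rewrite -cT mulr_natl -sumr_const; apply: ltr_sum => //.
  by apply/hasP; exists b0; rewrite // mem_index_enum.
rewrite ltNge => /negP; apply; apply: le_trans t1P.
rewrite -natr_sum -natrD ler_nat; apply: leq_trans (ldeg_sum T) _.
by rewrite cT leq_add2r bigcup_nb_le.
Qed.

Lemma big_ldeg_sum : \sum_(b in big_b) (ldeg J be h b)%:R <= (k + t1 ^ 2 * (r * S))%:R :> R.
Proof.
rewrite -natr_sum ler_nat; apply: leq_trans (ldeg_sum _) _.
by rewrite leq_add ?bigcup_nb_le // leq_mul2r leq_sqr card_big_b orbT.
Qed.

(** Four kinds of pairs: equal labels, a common neighbour with at most [D] labels, one with between
    [D] and [th] labels, and a larger common neighbour of the own colour. In the third kind a block
    closes at most ldeg^2 <= th ldeg pairs, and the sum of these degrees is bounded. *)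
Lemma card_lightly_closed :
  #|[set e | lightly_closed J be th h e g]|%:R <=
  (k * S)%:R + (z1 + 2 * D * S%:R * y) + th * (k + t1 ^ 2 * (r * S))%:R +
  (z2 + 2 * d%:R * y).
Proof.
pose X1 := \bigcup_(a in J) setX [set a] [set c in J | be c == be a].
pose X2 := \bigcup_(b | (ldeg J be h b)%:R <= D) lpairs J be h b.
pose X3 := \bigcup_(b in [set b in big_b | (ldeg J be h b)%:R <= th]) setX (nb b) (nb b).
(* The own colour is treated with the identity labelling; as all degrees are at most [d], every
   block is light for the cut [d]. *)
pose X4 := \bigcup_(c | (ldeg J id g c)%:R <= d%:R :> R) lpairs J id g c.
have sub : [set e | lightly_closed J be th h e g] \subset X1 :|: X2 :|: X3 :|: X4.
  apply/subsetP => -[a c]; rewrite !in_setU inE /lightly_closed /pairs inE /=.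
  case/andP=> /and3P[aJ cJ ac] cl.
  case: (eqVneq (be a) (be c)) cl => [e _|ne /=].
    by apply/orP; left; apply/orP; left; apply/orP; left; apply/bigcupP; exists a;
       rewrite // !inE /= eqxx cJ e eqxx.
  case/orP=> /existsP[b /and3P[hb b1 b2]].
    case: (lerP (ldeg J be h b)%:R D) => hD.
      apply/orP; left; apply/orP; left; apply/orP; right; apply/bigcupP.
      by exists b; rewrite // !inE /= aJ cJ ne b1 b2.
    apply/orP; left; apply/orP; right; apply/bigcupP.
    by exists b; rewrite !inE /= ?hD ?aJ ?cJ ?b1 ?b2.
  apply/orP; right; apply/bigcupP; exists b.
    rewrite ler_nat; apply: leq_trans (gdeg b); apply: subset_leq_card.
    by apply/subsetP => x; rewrite !inE => /andP[].
  by rewrite !inE /= aJ cJ b1 b2 !andbT /=; apply: contraTneq ac => ->; rewrite ltnn.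
have c1 : #|X1|%:R <= (k * S)%:R :> R.
  rewrite ler_nat; apply: leq_trans (card_bigcup_le _ _) _.
  apply: (@leq_trans (\sum_(a in J) S)).
    by apply: leq_sum => a _; rewrite cardsX cards1 mul1n.
  by rewrite sum_nat_const leq_mul2r Jk orbT.
have c2 : #|X2|%:R <= z1 + 2 * D * S%:R * y.
  apply: (@le_trans _ _ (\sum_(b | (ldeg J be h b)%:R <= D) #|lpairs J be h b|%:R)).
    by rewrite -natr_sum ler_nat card_bigcup_le.
  by apply: (light_sum (J' := J')) => // b; rewrite ler_nat.
have c3 : #|X3|%:R <= th * (k + t1 ^ 2 * (r * S))%:R.
  apply: (@le_trans _ _ (\sum_(b in [set b in big_b | (ldeg J be h b)%:R <= th])
       th * (ldeg J be h b)%:R)).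
    apply: (@le_trans _ _ (\sum_(b in [set b in big_b | (ldeg J be h b)%:R <= th])
       #|setX (nb b) (nb b)|%:R)); first by rewrite -natr_sum ler_nat card_bigcup_le.
    apply: ler_sum => b; rewrite inE => /andP[_ hb].
    by rewrite cardsX natrM ler_wpM2r.
  rewrite -mulr_sumr ler_wpM2l //; first exact: le_trans Dth.
  apply: le_trans big_ldeg_sum; rewrite [leLHS]big_mkcond [leRHS]big_mkcond /=.
  by apply: ler_sum => b _; rewrite inE; case: (b \in big_b) => //=; case: ifP.
have c4 : #|X4|%:R <= z2 + 2 * d%:R * y.
  apply: (@le_trans _ _ (\sum_(b | (ldeg J id g b)%:R <= d%:R :> R) #|lpairs J id g b|%:R)).
    by rewrite -natr_sum ler_nat card_bigcup_le.
  rewrite -[2 * d%:R]mulr1; apply: (light_sum (J' := J)) => // b; rewrite /mult.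
  rewrite (_ : 1 = 1%:R) // ler_nat; apply: leq_trans (_ : #|[set b]| <= 1)%N; last by rewrite cards1.
  by apply: subset_leq_card; apply/subsetP => x; rewrite !inE => /andP[_].
apply: (@le_trans _ _ (#|X1| + #|X2| + #|X3| + #|X4|)%:R).
  rewrite ler_nat; apply: leq_trans (subset_leq_card sub) _.
  apply: leq_trans (leq_card_setU _ _) _; rewrite leq_add2r.
  apply: leq_trans (leq_card_setU _ _) _; rewrite leq_add2r.
  exact: leq_card_setU.
by move: c1 c2 c3 c4; rewrite !natrD; lra.
Qed.

(** At most [t0] blocks are heavy, and their neighbourhoods form the family. A heavy block covers at
    most xk / 2 times its degree many pairs; by Bonferroni and [HN] these degrees sum to k - |J'| up
    to small errors. *)
Lemma heavy_family : exists A : {ffun 'I_t0 -> {set 'I_m}},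
  [/\ forall i, (#|A i| <= d)%N,
      #|covered J be A|%:R <=
        xk / 2 * (k%:R - #|J'|%:R + (t0 * d)%:R + (t0 ^ 2 * (r * S))%:R)
    & forall e, e \in pairs J -> edge_closed be g h e ->
        lightly_closed J be th h e g \/ e \in covered J be A].
Proof.
pose T := [set b | th < (ldeg J be h b)%:R].
have th0 : 0 <= th by exact: le_trans Dth.
have Tbig : T \subset big_b.
  by apply/subsetP => b; rewrite !inE; exact: le_lt_trans.
have Tt0 : (#|T| <= t0)%N.
  rewrite leqNgt; apply/negP => lt.
  have [b0 b0T] : exists b, b \in T by apply/card_gt0P; exact: leq_ltn_trans lt.
  have : #|T|%:R * th < \sum_(b in T) (ldeg J be h b)%:R.
    rewrite mulr_natl -sumr_const; apply: ltr_sum => [|b]; last by rewrite inE.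
    by apply/hasP; exists b0; rewrite // mem_index_enum.
  rewrite ltNge => /negP; apply.
  apply: (@le_trans _ _ (t0%:R * th)); last by rewrite ler_wpM2r // ler_nat ltnW.
  apply: le_trans t0P; rewrite -natrD; apply: le_trans big_ldeg_sum.
  rewrite [leLHS]big_mkcond [leRHS]big_mkcond /=; apply: ler_sum => b _.
  by case: ifP => [/(subsetP Tbig) -> //|_]; case: ifP.
(* Unfilled places of the [t0]-tuple receive the empty set, which covers nothing. *)
pose s := [seq nbr h b | b <- enum T].
exists [ffun i : 'I_t0 => nth set0 s i]; split.
- move=> i; rewrite ffunE; case: (ltnP i (size s)) => hi; last by rewrite nth_default // cards0.
  have /mapP[b _ ->] := mem_nth set0 hi; exact: hdeg.
- have sub : covered J be [ffun i : 'I_t0 => nth set0 s i] \subset \bigcup_(b in T) pairs (nb b).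
    apply/subsetP => -[a c]; rewrite !inE /= => /andP[/and3P[aJ cJ ac]].
    case/existsP=> i; rewrite ffunE; case: (ltnP i (size s)) => hi; last first.
      by rewrite nth_default // !inE.
    have /mapP[b bT ->] := mem_nth set0 hi; rewrite !inE => /andP[b1 b2].
    apply/bigcupP; exists b; first by rewrite -mem_enum.
    by rewrite !inE /= aJ cJ b1 b2.
  apply: (@le_trans _ _ (\sum_(b in T) #|pairs (nb b)|%:R)).
    rewrite -natr_sum ler_nat; apply: leq_trans (subset_leq_card sub) _.
    exact: card_bigcup_le.
  apply: (@le_trans _ _ (\sum_(b in T) xk / 2 * (ldeg J be h b)%:R)).
    apply: ler_sum => b _; rewrite card_pairsE /nb -/(ldeg J be h b).
    have : (ldeg J be h b)%:R * (ldeg J be h b)%:R <= xk * (ldeg J be h b)%:R.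
      by rewrite ler_wpM2r.
    have : 0 <= (ldeg J be h b)%:R :> R by [].
    rewrite expr2; lra.
  rewrite -mulr_sumr.
  have le2 : (\sum_(b in T) ldeg J be h b + #|J'| <=
      k + t0 * d + t0 ^ 2 * (r * S))%N.
    apply: (@leq_trans (#|\bigcup_(b in T) nb b| + #|T| ^ 2 * (r * S) + #|J'|)).
      by rewrite leq_add2r ldeg_sum.
    have := HN (\bigcup_(b in T) nbr h b).
    rewrite (_ : [set a in J | be a \in \bigcup_(b in T) nbr h b] = \bigcup_(b in T) nb b); last first.
      apply/setP => a; rewrite inE; apply/andP/bigcupP => [[aJ /bigcupP[b bT]]|[b bT]].
        by rewrite inE => hb; exists b; rewrite // inE aJ.
      by rewrite inE => /andP[aJ hb]; split=> //; apply/bigcupP; exists b; rewrite // inE.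
    have le3 : (#|\bigcup_(b in T) nbr h b| <= t0 * d)%N.
      apply: leq_trans (card_bigcup_le _ _) _.
      apply: (@leq_trans (\sum_(b in T) d)); first by apply: leq_sum.
      by rewrite sum_nat_const leq_mul2r Tt0 orbT.
    have le4 : (#|T| ^ 2 * (r * S) <= t0 ^ 2 * (r * S))%N.
      by rewrite leq_mul2r leq_sqr Tt0 orbT.
    move=> le1; rewrite addnAC leq_add //; apply: leq_trans le1 _.
    by rewrite leq_add2l.
  rewrite ler_wpM2l //; first by rewrite divr_ge0.
  move: le2; rewrite -(ler_nat R) !natrD natr_sum; lra.
- move=> e eJ; case/orP=> /existsP[b].
    case/andP=> b1 b2; case: (lerP (ldeg J be h b)%:R th) => hb.
      left; rewrite /lightly_closed eJ /=; apply/orP; right; apply/orP; left.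
      by apply/existsP; exists b; rewrite hb b1 b2.
    right; rewrite inE eJ /=; apply/existsP.
    have bT : b \in T by rewrite inE.
    have ib : (index b (enum T) < t0)%N.
      by apply: leq_trans Tt0; rewrite cardE index_mem mem_enum.
    exists (Ordinal ib); rewrite ffunE /= /s (nth_map b) ?index_mem ?mem_enum //.
    by rewrite nth_index ?mem_enum // !inE b1 b2.
  move=> hc; left; rewrite /lightly_closed eJ /=; apply/orP; right; apply/orP; right.
  by apply/existsP; exists b.
Qed.

End Deterministic.
End Side.

(** * The construction *)

Section LowEvent.
Variables (R : realType) (m : nat) (p : R).
Hypotheses (p_ge0 : 0 <= p) (p_le1 : p <= 1).

(** The family is quantified over all tuples of small sets instead of being taken from [h], so the
    event depends on [g] alone. This makes the events of the two colours independent, at the price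
    of a union bound over families. *)
Definition few_uncovered (J : {set 'I_m}) (be : 'I_m -> 'I_m) (t d : nat) (K z : R)
    (g : {ffun 'I_m * 'I_m -> bool}) :=
  [exists A : {ffun 'I_t -> {set 'I_m}},
    [&& [forall i, #|A i| <= d]%N, #|covered J be A|%:R <= K
      & #|[set e in pairs J :\: covered J be A | g e]|%:R <= z]].

Lemma few_uncovered_tail J be t d (K z la : R) : 0 <= la ->
  Pr (bern p) (few_uncovered J be t d K z) <=
  ((m.+1 ^ d) ^ t)%:R *
  expR (la * z - p * (1 - expR (- la)) * ((#|J|%:R ^+ 2 - #|J|%:R) / 2 - K)).
Proof.
move=> la0; set C := expR _.
pose small := [set B : {set 'I_m} | #|B| <= d]%N.
pose good (A : {ffun 'I_t -> {set 'I_m}}) :=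
  (A \in ffun_on (mem small)) && (#|covered J be A|%:R <= K).
apply: (@le_trans _ _ (Pr (bern p) (fun g => [exists A, good A &&
    (#|[set e in pairs J :\: covered J be A | g e]|%:R <= z)]))).
  apply: Pr_sub => [|g]; first exact: bern_ge0.
  case/existsP=> A /and3P[/forallP sA cA gA]; apply/existsP; exists A.
  by rewrite /good cA gA !andbT; apply/ffun_onP => i; rewrite inE.
apply: le_trans (Pr_exists_le (bern_ge0 p_ge0 p_le1) _ _) _.
apply: (@le_trans _ _ (\sum_(A | good A) C)).
  apply: ler_sum => A /andP[_ cA].
  (* The lower tail is the Chernoff bound at the negative parameter [- la]. *)
  apply: (@le_trans _ _ (Pr (bern p) (fun g : {ffun _ -> bool} => - la * z <=
     - la * #|[set e in pairs J :\: covered J be A | g e]|%:R))).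
    apply: Pr_sub => [|g hg]; first exact: bern_ge0.
    by rewrite !mulNr lerN2 ler_wpM2l.
  apply: le_trans (card_tail p_ge0 p_le1 _ _ _) _; rewrite ler_expR.
  have e1 : expR (- la) <= 1 by rewrite -[leRHS]expR0 ler_expR oppr_le0.
  have pe : 0 <= p * (1 - expR (- la)) by rewrite mulr_ge0 // subr_ge0.
  have cD : (#|J|%:R ^+ 2 - #|J|%:R) / 2 - K <= #|pairs J :\: covered J be A|%:R.
    rewrite -card_pairsE.
    have : (#|pairs J| <= #|pairs J :\: covered J be A| + #|covered J be A|)%N.
      rewrite -(cardsID (covered J be A) (pairs J)) addnC leq_add2l.
      by rewrite subset_leq_card // subsetIr.
    rewrite -(ler_nat R) natrD; lra.
  have := ler_wpM2l pe cD; lra.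
rewrite sumr_const -[C *+ _]mulr_natl ler_wpM2r ?expR_ge0 // ler_nat.
apply: (@leq_trans #|ffun_on (mem small) : {pred {ffun 'I_t -> {set 'I_m}}}|).
  by apply: subset_leq_card; apply/subsetP => A /andP[].
rewrite card_ffun_on card_ord.
have := card_small_sets m d; rewrite -/small.
rewrite (eq_card (_ : mem small =i small)) //.
by case: t {good} => // t; rewrite leq_exp2r.
Qed.

End LowEvent.

Section Construction.
Variables (n m : nat).
Implicit Types (g h : {ffun 'I_m * 'I_m -> bool}) (pe pc : 'I_n -> 'I_m) (I : {set 'I_n}).

(* The edge [uv] has the colour of [g], whose projection is [pe]; the other colour has the
   graph [h] and the projection [pc]. *)
Definition kept pe pc g h (u v : 'I_n) :=
  [&& adj g (pe u) (pe v),
      ~~ [exists b, adj h b (pc u) && adj h b (pc v)]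
    & ~~ [exists c : 'I_m, [&& (maxn (pe u) (pe v) < c)%N, adj g c (pe u) & adj g c (pe v)]]].

Definition two_bite pe pc g h u v := kept pe pc g h u v || kept pc pe h g u v.

Lemma kept_sym pe pc g h u v : kept pe pc g h u v = kept pe pc g h v u.
Proof.
rewrite /kept adjC maxnC; congr [&& _, ~~ _ & ~~ _].
  by apply: eq_existsb => b; rewrite andbC.
by apply: eq_existsb => c; rewrite [adj g c (pe u) && _]andbC.
Qed.

(** The block [pe w] is a common neighbour of [pe u] and [pe v], which deletes [uv] from the other
    colour. *)
Lemma kept_mixed pe pc g h u v w :
  kept pe pc g h u w -> kept pe pc g h v w -> ~~ kept pc pe h g u v.
Proof.
move=> /and3P[uw _ _] /and3P[vw _ _]; apply/negP => /and3P[_ /existsP + _]; apply.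
by exists (pe w); rewrite ![adj g (pe w) _]adjC uw vw.
Qed.

(** Of three pairwise adjacent blocks the largest is a common neighbour above the other two, so the
    edge opposite to it was deleted. *)
Lemma kept_mono pe pc g h u v w :
  kept pe pc g h u v -> kept pe pc g h v w -> ~~ kept pe pc g h u w.
Proof.
have key_step x y z : kept pe pc g h x y -> adj g (pe z) (pe x) -> adj g (pe z) (pe y) ->
    (pe x < pe z)%N -> (pe y < pe z)%N -> False.
  move=> /and3P[_ _ /existsP nex] zx zy xz yz; apply: nex; exists (pe z).
  by rewrite gtn_max xz yz zx zy.
move=> uv vw; apply/negP => uw.
have Auv : adj g (pe u) (pe v) by case/and3P: uv.
have Avw : adj g (pe v) (pe w) by case/and3P: vw.
have Auw : adj g (pe u) (pe w) by case/and3P: uw.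
have ne x y : adj g (pe x) (pe y) -> pe x != pe y :> nat by case/andP.
have := ne _ _ Auv; have := ne _ _ Avw; have := ne _ _ Auw.
case: (ltngtP (pe u) (pe v)) => // h1 h2 h3 _.
  case: (ltngtP (pe v) (pe w)) h3 => // h3 _.
    by apply: (key_step u v w) => //; [rewrite adjC|rewrite adjC|apply: ltn_trans h3].
  by apply: (key_step u w v) => //; [rewrite adjC].
case: (ltngtP (pe u) (pe w)) h2 => // h2 _.
  by apply: (key_step u v w) => //; [rewrite adjC|rewrite adjC|apply: ltn_trans h2].
by apply: (key_step v w u) => //.
Qed.

Lemma two_bite_sym pe pc g h u v : two_bite pe pc g h u v = two_bite pe pc g h v u.
Proof. by rewrite /two_bite kept_sym [kept pc _ _ _ _ _]kept_sym. Qed.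

Lemma two_bite_irr pe pc g h u : two_bite pe pc g h u u = false.
Proof. by rewrite /two_bite /kept /adj !eqxx. Qed.

(** Two of the three edges share a colour; the third is excluded in that colour by [kept_mono] and
    in the other by [kept_mixed]. *)
Lemma two_bite_triangle pe pc g h u v w :
  two_bite pe pc g h u v -> two_bite pe pc g h v w -> ~~ two_bite pe pc g h u w.
Proof.
rewrite /two_bite => /orP[] uv /orP[] vw; rewrite negb_or.
- by rewrite (kept_mono uv vw) (kept_mixed uv) // kept_sym.
- apply/andP; split; apply/negP => uw.
    by have /negP := kept_mixed (pe := pe) (h := h) (u := v) (v := w) (w := u)
      (etrans (kept_sym _ _ _ _ _ _) uv) (etrans (kept_sym _ _ _ _ _ _) uw); apply.
  have /negP := kept_mixed (pe := pc) (h := g) (u := u) (v := v) (w := w) uw vw.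
  by apply.
- apply/andP; split; apply/negP => uw.
    by have /negP := kept_mixed (pe := pe) (h := h) (u := u) (v := v) (w := w) uw vw; apply.
  by have /negP := kept_mixed (pe := pc) (h := g) (u := v) (v := w) (w := u)
      (etrans (kept_sym _ _ _ _ _ _) uv) (etrans (kept_sym _ _ _ _ _ _) uw); apply.
- by rewrite (kept_mono uv vw) (kept_mixed uv) // kept_sym.
Qed.

(** Each block met by [I] picks one representative in [I] and is labelled by that vertex's block in
    the other colour. A block that misses [I] is its own label. *)
Definition label pe pc I (a : 'I_m) : 'I_m :=
  if [pick u in I | pe u == a] is Some u then pc u else a.

Lemma labelP pe pc I a : a \in pe @: I ->
  exists u, [/\ u \in I, pe u = a & label pe pc I a = pc u].
Proof.
case/imsetP=> u uI au; rewrite /label; case: pickP => [w /andP[wI /eqP]|/(_ u)].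
  by exists w.
by rewrite uI au eqxx.
Qed.

Lemma label_im pe pc I a : a \in pe @: I -> label pe pc I a \in pc @: I.
Proof. by case/(labelP pc)=> u [uI _ ->]; apply: imset_f. Qed.

Lemma label_card pe pc I (P : pred 'I_m) :
  (#|[set a in pe @: I | P (label pe pc I a)]| <= #|[set u in I | P (pc u)]|)%N.
Proof.
apply: leq_trans (leq_imset_card pe [set u in I | P (pc u)]); apply: subset_leq_card.
apply/subsetP => a; rewrite inE => /andP[/(labelP pc)[u [uI ua ->]] Pu].
by apply/imsetP; exists u; rewrite // inE uI.
Qed.

(** A block of [pc @: I] lies in [N] or is the image of a vertex of [I] sent outside [N]. So a set
    of few blocks holds little more than |I| - |pc @: I| labels. *)
Lemma label_cover pe pc I (N : {set 'I_m}) :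
  (#|[set a in pe @: I | label pe pc I a \in N]| + #|pc @: I| <= #|I| + #|N|)%N.
Proof.
apply: (@leq_trans (#|[set u in I | pc u \in N]| + #|pc @: I|)).
  by rewrite leq_add2r (label_card pe pc I (mem N)).
rewrite -(cardsID [set u | pc u \in N] I) -addnA leq_add //.
  by apply: subset_leq_card; apply/subsetP => u; rewrite !inE.
apply: (@leq_trans #|N :|: pc @: (I :\: [set u | pc u \in N])|).
  apply: subset_leq_card; apply/subsetP => b /imsetP[u uI ->].
  rewrite inE; case: (boolP (pc u \in N)) => //= uN.
  by apply/imsetP; exists u; rewrite // !inE uN.
apply: leq_trans (leq_card_setU _ _) _; rewrite addnC leq_add2r.
exact: leq_imset_card.
Qed.

(** An edge between two blocks of [I] would join their representatives unless it was deleted, and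
    the labels are the other blocks of exactly these representatives. *)
Lemma independent_closed pe pc g h I :
  (forall u v, u \in I -> v \in I -> ~~ kept pe pc g h u v) ->
  forall e, e \in pairs (pe @: I) -> g e -> edge_closed (label pe pc I) g h e.
Proof.
move=> ind [a c]; rewrite inE /= => /and3P[/(labelP pc)[u [uI ua la]] /(labelP pc)[v [vI vc lc]] ac] ge.
have := ind u v uI vI; rewrite /kept ua vc /adj -val_eqE /= ltn_eqF //= /key ac ge /=.
rewrite -negb_or negbK /edge_closed /= la lc; case/orP => [->//|hc]; apply/orP; right.
move: hc; rewrite (maxn_idPr (ltnW ac)) //.
Qed.

End Construction.

(** * Two independent samples *)

Section TwoSamples.
Variables (R : realType) (A T : finType) (mu : T -> R).
Hypothesis mu_ge0 : forall t, 0 <= mu t.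
Hypothesis mu_sum : \sum_t mu t = 1.
Implicit Types P Q : {ffun A -> T} -> {ffun A -> T} -> bool.

Definition Pr2 P : R := Ex mu (fun g => Pr mu (P g)).

Lemma Pr2_swap P : Pr2 P = Pr2 (fun h g => P g h).
Proof.
rewrite /Pr2 /Pr /Ex; under eq_bigr do rewrite big_distrr /=.
rewrite exchange_big /=; apply: eq_bigr => h _; rewrite big_distrr /=.
by apply: eq_bigr => g _; rewrite mulrCA.
Qed.

Lemma Pr2_sub P Q : (forall g h, P g h -> Q g h) -> Pr2 P <= Pr2 Q.
Proof. by move=> PQ; apply: Ex_le => // g; apply: Pr_sub => // h; exact: PQ. Qed.

Lemma Pr2U P Q : Pr2 (fun g h => P g h || Q g h) <= Pr2 P + Pr2 Q.
Proof. by rewrite /Pr2 -ExD; apply: Ex_le => // g; apply: PrU. Qed.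

Lemma Pr2_exists_le (I : finType) (K : pred I) (F : I -> _ -> _ -> bool) :
  Pr2 (fun g h => [exists i, K i && F i g h]) <= \sum_(i | K i) Pr2 (F i).
Proof. by rewrite /Pr2 -Ex_sum; apply: Ex_le => // g; apply: Pr_exists_le. Qed.

Lemma Pr2_fst P (c : R) : (forall h, Pr mu (P^~ h) <= c) -> Pr2 P <= c.
Proof.
move=> Pc; rewrite Pr2_swap /Pr2 -[leRHS](Ex_cst A mu_sum c).
by apply: Ex_le.
Qed.

Lemma Pr2_snd P (c : R) : (forall g, Pr mu (P g) <= c) -> Pr2 P <= c.
Proof.
by move=> Pc; rewrite /Pr2 -[leRHS](Ex_cst A mu_sum c); apply: Ex_le.
Qed.

Lemma Pr2_prod (P Q : {ffun A -> T} -> bool) :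
  Pr2 (fun g h => P g && Q h) = Pr mu P * Pr mu Q.
Proof.
rewrite /Pr2 mulrC /Pr -ExZ; apply: Ex_ext => g; rewrite mulrC -ExZ.
by apply: Ex_ext => h; rewrite -natrM mulnb.
Qed.

Lemma Pr2_lt1 P : Pr2 P < 1 -> exists g h, ~~ P g h.
Proof.
case/(Ex_lt_exists mu_ge0 mu_sum) => g /(Ex_lt_exists mu_ge0 mu_sum)[h Pgh].
by exists g, h; case: (P g h) Pgh; rewrite // ltxx.
Qed.

End TwoSamples.

(* [S] bounds the sizes of the blocks, [d] the degrees and [r] the codegrees of the reduced
   graphs, and [xk] the number of vertices in a neighbourhood. A block is light when at most
   [D] labels are adjacent to it and heavy when more than [th] are; at most [t1] blocks are
   not light and at most [t0] are heavy. [y], [z1], [cX] and [z] bound the edges inside [I],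
   the lightly closed pairs of one kind, all lightly closed pairs, and the edges among these;
   [la], [t], [lam] and [tx] are parameters of exponential moments. *)
Section Assembly.
Variables (R : realType) (n m k S d r t0 t1 : nat).
Variables (p D th xk y z1 cX z la t lam tx : R).
Implicit Types (g h : {ffun 'I_m * 'I_m -> bool}) (pe pc : 'I_n -> 'I_m) (I : {set 'I_n}).

Hypotheses (p_ge0 : 0 <= p) (p_le1 : p <= 1) (k_gt0 : (0 < k)%N).
Hypotheses (xk0 : 0 <= xk) (D0 : 0 <= D) (Dth : D <= th).
Hypothesis t1P : k%:R + (t1 ^ 2 * (r * S))%:R <= t1%:R * D :> R.
Hypothesis t0P : k%:R + (t1 ^ 2 * (r * S))%:R <= t0%:R * th :> R.
Hypothesis cXP : (k * S)%:R + (z1 + 2 * D * S%:R * y) +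
  th * (k + t1 ^ 2 * (r * S))%:R + (z1 + 2 * d%:R * y) <= cX.
Hypotheses (la0 : 0 <= la) (t_ge0 : 0 <= t) (lam0 : 0 <= lam).
Hypotheses (lDS : lam * D * S%:R <= 2^-1) (lDk : lam * D * k%:R * p <= 2^-1).
Hypotheses (ld : lam * d%:R <= 2^-1) (ldk : lam * d%:R * k%:R * p <= 2^-1).
Hypotheses (tx0 : 0 < tx) (txS : tx * S%:R <= 2^-1).

Let Bge0 := bern_ge0 p_ge0 p_le1.
Let Bsum := bern_sum p.

(** Deviations rare enough for a union bound over all [I]: many pairs closed by light outer blocks,
    many edges inside a block set, or many edges of [g] among few lightly closed pairs. *)
Definition exceptional pe pc I g h :=
  let J := pe @: I in let J' := pc @: I in let be := label pe pc I in
  [|| z1 <= \sum_(b | (b \notin J') && ((ldeg J be h b)%:R <= D)) #|lpairs J be h b|%:R,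
      y <= #|[set e in pairs J' | h e]|%:R,
      z1 <= \sum_(b | (b \notin J) && ((ldeg J id g b)%:R <= d%:R :> R)) #|lpairs J id g b|%:R,
      y <= #|[set e in pairs J | g e]|%:R
    | (#|[set e | lightly_closed J be th h e g]|%:R <= cX) &&
      (z <= #|[set e | lightly_closed J be th h e g && g e]|%:R)].

Definition exc_bound : R :=
  2 * expR (lam * (m%:R * (16 * (k%:R * p) ^+ 2) - z1)) +
  2 * expR (3 / 2 * p * k%:R ^+ 2 - y) + expR (p * (expR t - 1) * cX - t * z).

Lemma card_im_le pe I : #|I| = k -> (#|pe @: I| <= k)%N.
Proof. by move=> <-; exact: leq_imset_card. Qed.

Lemma exceptional_Pr2 pe pc I : #|I| = k ->
  (forall b, #|[set u | pc u == b]| <= S)%N ->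
  Pr2 (bern p) (exceptional pe pc I) <= exc_bound.
Proof.
move=> Ik pcS; rewrite /exceptional /=.
set J := pe @: I; set J' := pc @: I; set be := label pe pc I.
have kJ (pi : 'I_n -> 'I_m) : #|pi @: I|%:R <= k%:R :> R by rewrite ler_nat card_im_le.
have edges (pi : 'I_n -> 'I_m) :
    Pr (bern p) (fun g => y <= #|[set e in pairs (pi @: I) | g e]|%:R) <=
    expR (3 / 2 * p * k%:R ^+ 2 - y).
  apply: le_trans (edges_tail p_ge0 p_le1 _ _) _; rewrite ler_expR lerD2r ler_wpM2l //.
    by rewrite mulr_ge0 // divr_ge0.
  by rewrite lerXn2r ?nnegrE ?ler0n.
apply: (@le_trans _ _ (expR (lam * (m%:R * (16 * (k%:R * p) ^+ 2) - z1)) +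
   (expR (3 / 2 * p * k%:R ^+ 2 - y) + (expR (lam * (m%:R * (16 * (k%:R * p) ^+ 2) - z1)) +
   (expR (3 / 2 * p * k%:R ^+ 2 - y) + expR (p * (expR t - 1) * cX - t * z)))))); last first.
  rewrite /exc_bound; lra.
apply: le_trans (Pr2U Bge0 _ _) _; apply: lerD.
  apply: Pr2_snd => // g; apply: (light_tail (S := S%:R)) => //.
  - by move=> a; exact: label_im.
  - move=> b; rewrite ler_nat; apply: leq_trans (label_card pe pc I (pred1 b)) _.
    by apply: leq_trans (pcS b); apply: subset_leq_card; apply/subsetP => u; rewrite !inE => /andP[].
  - exact: kJ.
apply: le_trans (Pr2U Bge0 _ _) _; apply: lerD.
  by apply: Pr2_snd => // g; exact: edges.
apply: le_trans (Pr2U Bge0 _ _) _; apply: lerD.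
  apply: Pr2_fst => // h; apply: (light_tail (S := 1)) => //; [|exact: kJ|by rewrite mulr1].
  move=> b; rewrite -[1]/(1%:R) ler_nat; apply: leq_trans (_ : #|[set b]| <= 1)%N; last by rewrite cards1.
    by apply: subset_leq_card; apply/subsetP => x; rewrite !inE => /andP[_].
apply: le_trans (Pr2U Bge0 _ _) _; apply: lerD.
  by apply: Pr2_fst => // h; exact: edges.
(* With [h] fixed, the edges of [g] are revealed in the order of decreasing larger end. *)
apply: Pr2_fst => // h.
apply: (predictable_tail p_ge0 p_le1 (ht := fun e : 'I_m * 'I_m => e.2 : nat)) => // e.
exact: lightly_closed_predictable.
Qed.

(** None of these properties mentions [I], so their failure is paid for only once. The second one
    counts vertices through the projection and bounds every [ldeg]. *)
Definition typical pc g :=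
  [&& [forall b, #|nbr g b| <= d]%N, [forall b, #|[set u | adj g b (pc u)]|%:R <= xk]
    & [forall b, forall c, (b != c) ==> (codeg g b c <= r)%N]].

Definition typ_bound : R :=
  m%:R * expR (3 * p * m%:R - d%:R) +
  m%:R * expR (tx * (p * n%:R * (1 + 2 * (tx * S%:R)) - xk)) +
  m%:R ^+ 2 * expR (3 * p ^+ 2 * m%:R - r%:R).

Lemma typical_Pr pc : (forall b, #|[set u | pc u == b]| <= S)%N ->
  Pr (bern p) (fun g => ~~ typical pc g) <= typ_bound.
Proof.
move=> pcS.
pose P1 (b : 'I_m) g := d%:R <= #|nbr g b|%:R :> R.
pose P2 (b : 'I_m) g := xk <= #|[set u | adj g b (pc u)]|%:R.
pose P3 (b : 'I_m * 'I_m) g := r%:R <= (codeg g b.1 b.2)%:R :> R.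
apply: (@le_trans _ _ (Pr (bern p) (fun g => ([exists b, true && P1 b g] ||
   [exists b, true && P2 b g]) || [exists b : 'I_m * 'I_m, (b.1 != b.2) && P3 b g]))).
  apply: Pr_sub => // g; rewrite /typical !negb_and => /or3P[].
  - rewrite negb_forall => /existsP[b]; rewrite -ltnNge => /ltnW hb.
    by apply/orP; left; apply/orP; left; apply/existsP; exists b; rewrite /P1 ler_nat.
  - rewrite negb_forall => /existsP[b]; rewrite -ltNge => /ltW hb.
    by apply/orP; left; apply/orP; right; apply/existsP; exists b.
  rewrite negb_forall => /existsP[b]; rewrite negb_forall => /existsP[c].
  rewrite negb_imply => /andP[bc]; rewrite -ltnNge => /ltnW hb.
  by apply/orP; right; apply/existsP; exists (b, c); rewrite /= bc /P3 ler_nat.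
apply: le_trans (PrU Bge0 _ _) _; apply: lerD.
  apply: le_trans (PrU Bge0 _ _) _; apply: lerD.
    apply: le_trans (Pr_exists_le Bge0 _ _) _.
    apply: le_trans (ler_sum _ (fun b _ => deg_tail p_ge0 p_le1 b _)) _.
    by rewrite big_const_ord iter_addr_0 -[leLHS]mulr_natl.
  apply: le_trans (Pr_exists_le Bge0 _ _) _.
  rewrite mulr_natl -[X in _ *+ X]card_ord -sumr_const; apply: ler_sum => b _.
  pose v (a : 'I_m) : R := #|[set u | pc u == a]|%:R.
  have sv (F : 'I_m -> R) : \sum_a v a * F a = \sum_u F (pc u).
    rewrite [RHS](partition_big pc predT) //=; apply: eq_bigr => a _.
    rewrite (eq_bigr (fun=> F a)); last by move=> u /eqP ->.
    by rewrite sumr_const mulr_natl; congr (_ *+ _); apply: eq_card => u; rewrite !inE.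
  apply: (@le_trans _ _ (Pr (bern p) (fun g => xk <= wdeg g setT v b))).
    apply: Pr_sub => // g; congr (_ <= _ : Prop).
    rewrite /wdeg; under eq_bigl do rewrite inE.
    rewrite sv -sum1_card natr_sum [LHS]big_mkcond; apply: eq_bigr => u _.
    by rewrite inE; case: adj.
  have vge a : 0 <= v a by exact: ler0n.
  apply: le_trans (wdeg_tail p_ge0 p_le1 b xk tx0 vge) _; rewrite ler_expR mulrBr lerD2r.
  (* Block sizes are at most [S], so exp (tx v) - 1 is at most tx v (1 + 2 tx S); the sizes add up
     to [n]. *)
  apply: (@le_trans _ _ (p * \sum_a v a * (tx * (1 + 2 * (tx * S%:R))))).
    rewrite ler_wpM2l //; apply: ler_sum => a _.
    have vS : v a <= S%:R by rewrite ler_nat.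
    have tv0 : 0 <= tx * v a by rewrite mulr_ge0 // ltW.
    have tvS : tx * v a <= tx * S%:R by rewrite ler_wpM2l // ltW.
    have := expR_le_quad tv0 (le_trans tvS txS).
    have : tx * v a * (tx * v a) <= tx * v a * (tx * S%:R) by rewrite ler_wpM2l.
    rewrite expr2; lra.
  rewrite (sv (fun=> _)) sumr_const card_ord -[_ *+ n]mulr_natr; lra.
apply: le_trans (Pr_exists_le Bge0 _ _) _.
apply: (@le_trans _ _ (\sum_(b : 'I_m * 'I_m) expR (3 * p ^+ 2 * m%:R - r%:R))).
  rewrite big_mkcond /=; apply: ler_sum => b _; case: ifP => bc; last exact: expR_ge0.
  exact: codeg_tail.
by rewrite sumr_const card_prod !card_ord -[_ *+ (m * m)]mulr_natl natrM expr2.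
Qed.

Definition indep_in pe pc I g h :=
  [forall u in I, forall v in I, ~~ two_bite pe pc g h u v].

Definition heavy_bound (j : nat) : R :=
  xk / 2 * (k%:R - j%:R + (t0 * d)%:R + (t0 ^ 2 * (r * S))%:R).

(** Every edge of [g] between blocks of [I] is closed, hence lightly closed or covered by heavy
    neighbourhoods. Outside the exceptional events fewer than [z] edges are lightly closed, so at
    most [z] lie outside the covered pairs. *)
Lemma indep_side pe pc I g h : #|I| = k ->
  (forall b, #|[set u | pc u == b]| <= S)%N ->
  typical pe g -> typical pc h ->
  (forall u v, u \in I -> v \in I -> ~~ kept pe pc g h u v) ->
  exceptional pe pc I g h ||
  few_uncovered (pe @: I) (label pe pc I) t0 d (heavy_bound #|pc @: I|) z g.
Proof.
move=> Ik pcS /and3P[/forallP gd _ _] /and3P[/forallP hd /forallP hx /forallP hc] ind.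
rewrite /exceptional /=.
set J := pe @: I; set J' := pc @: I; set be := label pe pc I.
case: lerP => //= h1; case: lerP => //= h2; case: lerP => //= h3; case: lerP => //= h4.
have beJ a : a \in J -> be a \in J' by exact: label_im.
have mulS b : (#|[set a in J | be a == b]| <= S)%N.
  apply: leq_trans (label_card pe pc I (pred1 b)) _.
  by apply: leq_trans (pcS b); apply: subset_leq_card; apply/subsetP => u; rewrite !inE => /andP[].
have HN (N : {set 'I_m}) : (#|[set a in J | be a \in N]| + #|J'| <= k + #|N|)%N.
  by rewrite -Ik; exact: label_cover.
have hcod b c : b != c -> (codeg h b c <= r)%N.
  by move=> bc; have /forallP/(_ c)/implyP := hc b; apply.
have hxl b : (ldeg J be h b)%:R <= xk.
  apply: le_trans (hx b); rewrite ler_nat; apply: leq_trans (label_card pe pc I (adj h b)) _.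
  by apply: subset_leq_card; apply/subsetP => u; rewrite !inE => /andP[].
have Jk : (#|J| <= k)%N by exact: card_im_le.
have cl := card_lightly_closed beJ Jk mulS gd hcod D0 Dth t1P k_gt0
  (ltW h1) (ltW h2) (ltW h3) (ltW h4).
rewrite (le_trans cl cXP) /=; case: lerP => //= h5.
have [A [Ad Ac AP]] := @heavy_family R m J J' be g h k S d r t0 t1 D th xk Jk mulS HN hd
  hcod hxl xk0 D0 Dth t1P t0P k_gt0.
apply/existsP; exists A; rewrite Ac /= andbC; apply/andP; split; last by apply/forallP.
apply: le_trans (ltW h5); rewrite ler_nat; apply: subset_leq_card.
apply/subsetP => e; rewrite !in_set => /andP[/andP[eA eJ] ge]; rewrite ge andbT.
have ecl := independent_closed ind.
have ep : e \in pairs J by rewrite inE.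
by case: (AP e ep (ecl e ep ge)) => //; rewrite !inE (negPf eA).
Qed.

(** The bound for one colour involves the block numbers of both projections, the second one through
    [heavy_bound]. Here the terms are regrouped by projection, so that each factor depends on a
    single one. *)
Definition side_bound (j : nat) : R :=
  ((m.+1 ^ d) ^ t0)%:R *
  expR (la * z - p * (1 - expR (- la)) * ((j%:R ^+ 2 - j%:R) / 2 - heavy_bound j)).

Lemma indep_Pr2 pe pc I : #|I| = k ->
  (forall b, #|[set u | pe u == b]| <= S)%N -> (forall b, #|[set u | pc u == b]| <= S)%N ->
  Pr2 (bern p) (fun g h => [&& typical pe g, typical pc h & indep_in pe pc I g h]) <=
  2 * exc_bound + side_bound #|pe @: I| * side_bound #|pc @: I|.
Proof.
move=> Ik peS pcS.
pose F1 := few_uncovered (pe @: I) (label pe pc I) t0 d (heavy_bound #|pc @: I|) z.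
pose F2 := few_uncovered (pc @: I) (label pc pe I) t0 d (heavy_bound #|pe @: I|) z.
apply: (@le_trans _ _ (Pr2 (bern p) (fun g h =>
   (exceptional pe pc I g h || exceptional pc pe I h g) || (F1 g && F2 h)))).
  apply: Pr2_sub => // g h /and3P[tg th' /forall_inP ind].
  have ind1 u v : u \in I -> v \in I -> ~~ kept pe pc g h u v.
    by move=> uI vI; have /forall_inP/(_ v vI) := ind u uI; rewrite negb_or => /andP[].
  have ind2 u v : u \in I -> v \in I -> ~~ kept pc pe h g u v.
    by move=> uI vI; have /forall_inP/(_ v vI) := ind u uI; rewrite negb_or => /andP[].
  have := indep_side Ik pcS tg th' ind1; have := indep_side Ik peS th' tg ind2.
  rewrite -/(F1 g) -/(F2 h).
  by case: exceptional; case: exceptional => //= -> ->.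
apply: le_trans (Pr2U Bge0 _ _) _; apply: lerD.
  apply: le_trans (Pr2U Bge0 _ _) _; rewrite mulr2n mulrDl mul1r; apply: lerD.
    exact: exceptional_Pr2.
  by rewrite Pr2_swap; exact: exceptional_Pr2.
rewrite Pr2_prod.
apply: le_trans (ler_pM (Pr_ge0 Bge0 _) (Pr_ge0 Bge0 _)
  (few_uncovered_tail p_ge0 p_le1 _ _ _ _ _ _ la0)
  (few_uncovered_tail p_ge0 p_le1 _ _ _ _ _ _ la0)) _.
(* Both exponents contain [heavy_bound] with the same coefficient, so exchanging these terms between
   the two factors leaves the product unchanged. *)
rewrite /side_bound mulrACA [leRHS]mulrACA ler_wpM2l ?mulr_ge0 ?ler0n //.
by rewrite -!expRD ler_expR; lra.
Qed.

Lemma good_graph pe pc :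
  (forall b, #|[set u | pe u == b]| <= S)%N -> (forall b, #|[set u | pc u == b]| <= S)%N ->
  2 * typ_bound + 'C(n, k)%:R * (2 * exc_bound) +
  \sum_(I : {set 'I_n} | #|I| == k) side_bound #|pe @: I| * side_bound #|pc @: I| < 1 ->
  exists g h, forall I, #|I| = k -> ~~ indep_in pe pc I g h.
Proof.
move=> peS pcS lt1.
have [|g [h]] := @Pr2_lt1 R _ _ _ Bge0 Bsum (fun g h => (~~ typical pe g || ~~ typical pc h) ||
   [exists I : {set 'I_n}, (#|I| == k) && [&& typical pe g, typical pc h & indep_in pe pc I g h]]).
  apply: le_lt_trans lt1.
  apply: le_trans (Pr2U Bge0 _ _) _; rewrite -addrA; apply: lerD.
    apply: le_trans (Pr2U Bge0 _ _) _; rewrite mulr2n mulrDl mul1r; apply: lerD.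
      by apply: Pr2_fst => // h; exact: typical_Pr.
    by apply: Pr2_snd => // g; exact: typical_Pr.
  apply: le_trans (Pr2_exists_le Bge0 _ _) _.
  have -> : 'C(n, k) = #|[pred I : {set 'I_n} | #|I| == k]|.
    have := card_draws 'I_n k; rewrite card_ord => <-; apply: eq_card => I.
    by rewrite !inE.
  rewrite mulr_natl.
  rewrite -sumr_const -big_split /=; apply: ler_sum => I /eqP Ik.
  exact: indep_Pr2.
rewrite !negb_or => /andP[/andP[/negPn tg /negPn th']] nex; exists g, h => I Ik.
apply/negP => ind; case/negP: nex; apply/existsP; exists I.
by rewrite Ik eqxx tg th'.
Qed.

End Assembly.

(** * Random projections *)

Section Projections.
Variables (R : realType) (n m k S : nat) (phi : nat -> R).
Hypothesis m_gt0 : (0 < m)%N.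
Hypothesis phi_ge0 : forall j, 0 <= phi j.

Definition unif (_ : 'I_m) : R := m%:R^-1.

Lemma unif_ge0 t : 0 <= unif t.
Proof. by rewrite invr_ge0 ler0n. Qed.

Lemma unif_sum : \sum_t unif t = 1.
Proof.
by rewrite sumr_const card_ord -[_ *+ _]mulr_natr mulVf // pnatr_eq0 -lt0n.
Qed.

Lemma image_sub_Pr (I : {set 'I_n}) (J : {set 'I_m}) :
  Ex unif (fun pi => (pi @: I \subset J)%:R) = (#|J|%:R / m%:R) ^+ #|I|.
Proof.
rewrite (@Ex_ext _ _ _ _ _ (fun pi => \prod_(u <- enum I) (pi u \in J)%:R)); last first.
  move=> pi; rewrite big_enum /=; case: (boolP (pi @: I \subset J)) => [|/subsetPn[a]].
    by move/subsetP=> sub; rewrite big1 // => u uI; rewrite sub // imset_f.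
  by case/imsetP=> u uI -> /negPf nJ; rewrite (bigD1 u) //= nJ mul0r.
rewrite (Ex_prod_coord unif_sum (fun _ a => (a \in J)%:R) (enum_uniq _) (fun _ _ _ _ h => h)).
rewrite (eq_bigr (fun=> #|J|%:R / m%:R)); last first.
  move=> u _; rewrite -mulr_sumr mulrC; congr (_ * _).
  by rewrite -natr_sum -sum1_card big_mkcond [in RHS]big_mkcond /=.
by rewrite big_const_seq count_predT iter_mulr_1 -cardE.
Qed.

(** A union bound over the [j]-sets that may contain the image; [k] vertices all fall into a given
    one with probability (j / m)^k. *)
Definition image_bound : R :=
  \sum_(j < k.+1) phi j * ('C(m, j)%:R * (j%:R / m%:R) ^+ k).

Lemma image_size_Ex (I : {set 'I_n}) : #|I| = k ->
  Ex unif (fun pi => phi #|pi @: I|) <= image_bound.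
Proof.
move=> Ik.
apply: (@le_trans _ _ (Ex unif (fun pi => \sum_(j < k.+1)
   phi j * \sum_(J : {set 'I_m} | #|J| == j) (pi @: I \subset J)%:R))).
  apply: Ex_le => [|pi]; first exact: unif_ge0.
  have jk : (#|pi @: I| < k.+1)%N by rewrite ltnS -Ik leq_imset_card.
  have s0 (j : nat) : 0 <= \sum_(J : {set 'I_m} | #|J| == j) (pi @: I \subset J)%:R :> R.
    by apply: sumr_ge0 => J _; rewrite ler0n.
  rewrite (bigD1 (Ordinal jk)) //= -[leLHS]addr0 lerD //; last first.
    by apply: sumr_ge0 => j _; rewrite mulr_ge0.
  rewrite -[leLHS]mulr1 ler_wpM2l // (bigD1 (pi @: I)) //= subxx lerDl.
  by apply: sumr_ge0 => J _; rewrite ler0n.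
rewrite Ex_sum; apply: ler_sum => j _; rewrite ExZ ler_wpM2l // Ex_sum.
rewrite (eq_bigr (fun=> (j%:R / m%:R) ^+ k)); last first.
  by move=> J /eqP Jj; rewrite image_sub_Pr Jj Ik.
rewrite sumr_const -[leLHS]mulr_natl ler_wpM2r ?exprn_ge0 ?divr_ge0 // ler_nat.
have := card_draws 'I_m j; rewrite card_ord => <-; apply: subset_leq_card.
by apply/subsetP => J; rewrite !inE.
Qed.

Definition large_block (pi : {ffun 'I_n -> 'I_m}) :=
  [exists b, true && (S <= #|[set u | pi u == b]|)%N].

Lemma large_block_Pr : Pr unif large_block <= m%:R * expR (3 * n%:R / m%:R - S%:R).
Proof.
apply: le_trans (Pr_exists_le unif_ge0 _ _) _.
rewrite mulr_natl -[X in _ *+ X]card_ord -sumr_const; apply: ler_sum => b _.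
apply: (@le_trans _ _ (expR (- S%:R) * Ex unif (fun pi : {ffun 'I_n -> 'I_m} =>
   \prod_(u <- enum 'I_n) expR ((pi u == b)%:R)))).
  rewrite -ExZ; apply: Pr_markov => [||pi hS]; first exact: unif_ge0.
    by move=> pi; rewrite mulr_ge0 ?expR_ge0 ?prodr_ge0 // => u _; rewrite expR_ge0.
  rewrite -expR_sum -expRD -[leLHS]expR0 ler_expR addrC subr_ge0.
  rewrite big_enum /= -natr_sum ler_nat; apply: leq_trans hS _.
  rewrite -sum1_card big_mkcond /=; apply: leq_sum => u _.
  by rewrite inE; case: eqP.
rewrite (Ex_prod_coord unif_sum (fun _ a => expR ((a == b)%:R)) (enum_uniq _) (fun _ _ _ _ h => h)).
rewrite addrC expRD ler_wpM2l ?expR_ge0 //.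
have -> : 3 * n%:R / m%:R = (3 / m%:R) * n%:R :> R by ring.
rewrite expRM_natr big_const_seq count_predT iter_mulr_1 -cardE card_ord.
have m0 : m%:R != 0 :> R by rewrite pnatr_eq0 -lt0n.
apply: lerXn2r; rewrite ?nnegrE ?expR_ge0 //.
  by apply: sumr_ge0 => a _; rewrite mulr_ge0 ?unif_ge0 ?expR_ge0.
apply: le_trans (expR_ge1Dx _).
rewrite (eq_bigr (fun a => m%:R^-1 + (if a == b then m%:R^-1 * (expR 1 - 1) else 0))); last first.
  by move=> a _; rewrite /unif; case: eqP => _ /=; rewrite ?expR0; ring.
rewrite big_split /= -big_mkcond /= big_pred1_eq sumr_const card_ord -[_ *+ m]mulr_natr mulVf //.
rewrite lerD2l mulrC ler_wpM2r ?invr_ge0 //.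
by have := expR1_le4 R; lra.
Qed.

Lemma good_projections :
  2 * (m%:R * expR (3 * n%:R / m%:R - S%:R)) + 2 * ('C(n, k)%:R * image_bound ^+ 2) < 1 ->
  exists pe pc : 'I_n -> 'I_m,
    [/\ (forall b, #|[set u | pe u == b]| <= S)%N, (forall b, #|[set u | pc u == b]| <= S)%N
      & \sum_(I : {set 'I_n} | #|I| == k) phi #|pe @: I| * phi #|pc @: I| <= 2^-1].
Proof.
move=> lt1.
(* A value below 1 forces both indicators to vanish and the sum to be below 1/2. *)
pose F (pe pc : {ffun 'I_n -> 'I_m}) : R := ((large_block pe)%:R + (large_block pc)%:R) +
  2 * \sum_(I : {set 'I_n} | #|I| == k) phi #|pe @: I| * phi #|pc @: I|.
have ib0 : 0 <= image_bound.
  by apply: sumr_ge0 => j _; rewrite !mulr_ge0 ?exprn_ge0 ?divr_ge0.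
have : Ex unif (fun pe => Ex unif (F pe)) < 1.
  apply: le_lt_trans lt1.
  rewrite (@Ex_ext _ _ _ _ _ (fun pe => ((large_block pe)%:R + Pr unif large_block) +
    2 * \sum_(I : {set 'I_n} | #|I| == k) phi #|pe @: I| * Ex unif (fun pc => phi #|pc @: I|))); last first.
    move=> pe; rewrite /F ExD ExD ExZ Ex_sum (Ex_cst _ unif_sum).
    by congr (_ + 2 * _); apply: eq_bigr => I _; rewrite ExZ.
  rewrite ExD ExD (Ex_cst _ unif_sum) ExZ Ex_sum; apply: lerD.
    by have := large_block_Pr; rewrite /Pr; lra.
  rewrite ler_wpM2l //.
  have -> : 'C(n, k) = #|[pred I : {set 'I_n} | #|I| == k]|.
    have := card_draws 'I_n k; rewrite card_ord => <-; apply: eq_card => I.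
    by rewrite !inE.
  rewrite mulr_natl -sumr_const; apply: ler_sum => I /eqP Ik.
  pose E0 := Ex unif (fun pi : {ffun 'I_n -> 'I_m} => phi #|pi @: I|).
  have -> : Ex unif (fun pi : {ffun 'I_n -> 'I_m} => phi #|pi @: I| * E0) = E0 * E0.
    by rewrite -ExZ; apply: Ex_ext => pi; exact: mulrC.
  have e0 : 0 <= E0.
    by apply: Ex_ge0 => //; exact: unif_ge0.
  by rewrite expr2; apply: ler_pM => //; exact: image_size_Ex.
case/(Ex_lt_exists unif_ge0 unif_sum) => pe /(Ex_lt_exists unif_ge0 unif_sum)[pc].
rewrite /F; set s := \sum_(I | _) _.
have s0 : 0 <= s by apply: sumr_ge0 => I _; rewrite mulr_ge0.
have noblock (pi : {ffun 'I_n -> 'I_m}) : ~~ large_block pi ->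
    forall b, (#|[set u | pi u == b]| <= S)%N.
  by rewrite negb_exists => /forallP nl b; have := nl b; rewrite /= -ltnNge => /ltnW.
case: (boolP (large_block pe)) => Lpe; case: (boolP (large_block pc)) => Lpc /= lt;
  try (exfalso; move: lt; rewrite ltNge => /negP; apply; lra).
by exists pe, pc; split; [exact: noblock|exact: noblock|rewrite -/s; lra].
Qed.

End Projections.

(** * Choice of the parameters *)

Lemma expRN_le (R : realType) (x : R) : 0 < x -> expR (- x) <= x^-1.
Proof.
move=> x0; rewrite expRN lef_pV2 ?posrE ?expR_gt0 //.
by apply: le_trans (expR_ge1Dx x); rewrite lerDr.
Qed.

Lemma expR_ge_pow (R : realType) (x : R) (i : nat) :
  0 <= x -> i.+1`!%:R <= x -> x ^+ i <= expR x.
Proof.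
move=> x0 ix; apply: le_trans (expR_ge1Dxn i x0).
have f0 : 0 < i.+1`!%:R :> R by rewrite ltr0n fact_gt0.
apply: (@le_trans _ _ (x ^+ i.+1 / i.+1`!%:R)); last by rewrite lerDr.
by rewrite ler_pdivlMr // exprSr ler_wpM2l // exprn_ge0.
Qed.

Lemma ffact_le_expn (a b : nat) : (a ^_ b <= a ^ b)%N.
Proof. by elim: b => // b IH; rewrite ffactnSr expnSr leq_mul // leq_subr. Qed.

(** C(a, b) <= a^b / b!, and b^b / b! is at most e^b, being a term of its series. *)
Lemma bin_le_expR (R : realType) (a b : nat) : (0 < b)%N ->
  'C(a, b)%:R <= (a%:R / b%:R) ^+ b * expR b%:R :> R.
Proof.
move=> b0.
have f0 : 0 < b`!%:R :> R by rewrite ltr0n fact_gt0.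
have bb0 : 0 < b%:R ^+ b :> R by rewrite exprn_gt0 // ltr0n.
have h1 : 'C(a, b)%:R * b`!%:R <= a%:R ^+ b :> R.
  by rewrite -natrM bin_ffact -natrX ler_nat ffact_le_expn.
have h2 : b%:R ^+ b <= b`!%:R * expR b%:R :> R.
  case: b b0 f0 {bb0 h1} => // b _ f0.
  rewrite mulrC -ler_pdivrMr //; apply: le_trans (expR_ge1Dxn b _); last exact: ler0n.
  by rewrite lerDr.
rewrite expr_div_n mulrAC ler_pdivlMr //.
apply: (@le_trans _ _ ('C(a, b)%:R * (b`!%:R * expR b%:R))); first by rewrite ler_wpM2l.
by rewrite mulrA ler_wpM2r // expR_ge0.
Qed.

(** * The numerical inequalities, with K = k and L = log k *)

Section Numeric.
Variables (R : realType) (n m k S d r t0 t1 : nat) (L u : R).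
Let K : R := k%:R.
Hypotheses (u_gt0 : 0 < u) (uE : expR (40 * 1000) * u = 9^-1).
Hypothesis KE : K = expR L.
Hypothesis L_large : 100 * 1000 <= L.
Hypothesis uL : (100 * 1000) <= u * L.
Hypothesis K20 : L ^+ 20 <= K.
Hypothesis L4 : 2 * L ^+ 4 <= expR (L / 1000).
Hypothesis nP : n%:R * (3 * L) <= K ^+ 2.
Hypotheses (mP1 : m%:R * L ^+ 4 <= K ^+ 2) (mP2 : K ^+ 2 <= 2 * (m%:R * L ^+ 4)).
Hypothesis m_gt0 : (0 < m)%N.
Hypotheses (SP1 : S%:R <= 4 * L ^+ 3) (SP2 : 3 * L ^+ 3 <= S%:R).
Hypotheses (dP1 : d%:R * L ^+ 3 <= 5 * K) (dP2 : 5 * K <= (d%:R + 1) * L ^+ 3).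
Hypotheses (rP1 : r%:R <= 7 * L) (rP2 : 7 * L <= r%:R + 1).
Hypotheses (t1P1 : t1%:R <= 3 * L ^+ 5) (t1P2 : 2 * L ^+ 5 <= t1%:R).
Hypotheses (t0P1 : t0%:R <= L / 1000) (t0P2 : 2 <= t0%:R * u).

Definition edge_prob : R := 5 / 4 * L / K.
Definition light_cut : R := K / L ^+ 5.
Definition heavy_cut : R := u * K.
(** The mean [edge_prob * n] is at most 5/12 K; the exponential moment loses a factor 1.02, giving
    0.425 K. *)
Definition degree_cap : R := 43 / 100 * K.
Definition edge_cap : R := 6 * K * L.
Definition light_cap : R := u * K ^+ 2.
(** Seven shares of u K^2: one for equal labels and two each for light, intermediate and own-colour
    common neighbours. *)
Definition closed_cap : R := 7 * (u * K ^+ 2).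
Definition slack : R := K * L / (10 * 1000).
(** Chosen so that the rate times half of [light_cap] is 3 K L, well above the logarithm of the
    number of [k]-sets. *)
Definition light_rate : R := 6 * L / (u * K).
Definition degree_rate : R := (400 * L ^+ 3)^-1.

Lemma L_gt0 : 0 < L. Proof. by have := L_large; lra. Qed.
#[local] Hint Resolve L_gt0 : core.

Lemma Lx_gt0 i : 0 < L ^+ i. Proof. by rewrite exprn_gt0. Qed.
#[local] Hint Resolve Lx_gt0 : core.

Lemma L_ge0 : 0 <= L. Proof. exact: ltW. Qed.
Lemma Lx_ge0 i : 0 <= L ^+ i. Proof. exact: ltW. Qed.
#[local] Hint Resolve L_ge0 Lx_ge0 : core.

Lemma L_ge1 : 1 <= L. Proof. by have := L_large; lra. Qed.

Lemma K_gt0 : 0 < K. Proof. by rewrite KE expR_gt0. Qed.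
#[local] Hint Resolve K_gt0 : core.

Lemma K_ge0 : 0 <= K. Proof. exact: ltW. Qed.
Lemma u_ge0 : 0 <= u. Proof. exact: ltW u_gt0. Qed.
#[local] Hint Resolve u_gt0 K_ge0 u_ge0 : core.

Lemma Lx_le i j : (i <= j)%N -> L ^+ i <= L ^+ j.
Proof. by move=> ij; rewrite ler_weXn2l // L_ge1. Qed.

Lemma c_le_L (c : R) : c <= (100 * 1000) -> c <= L.
Proof. by move=> h; apply: le_trans L_large. Qed.

Lemma pow_le_K (c : R) (i : nat) : c <= (100 * 1000) -> (i < 20)%N -> c * L ^+ i <= K.
Proof.
move=> cL i20; apply: le_trans K20; apply: le_trans (Lx_le i20).
by rewrite exprS; apply: ler_wpM2r; [exact: ltW|exact: c_le_L].
Qed.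

Lemma edge_probK : edge_prob * K = 5 / 4 * L.
Proof. by rewrite /edge_prob mulfVK // gt_eqF. Qed.

Lemma edge_prob_ge0 : 0 <= edge_prob.
Proof. by rewrite /edge_prob !(mulr_ge0, invr_ge0). Qed.

Lemma edge_prob_le1 : edge_prob <= 1.
Proof.
rewrite /edge_prob ler_pdivrMr // mul1r -[L]expr1; apply: pow_le_K => //; lra.
Qed.

Lemma k_gt0 : (0 < k)%N.
Proof. by rewrite -(ltr_nat R); exact: K_gt0. Qed.

Lemma light_cut_ge0 : 0 <= light_cut. Proof. by rewrite /light_cut divr_ge0. Qed.

Lemma u_pow i : (0 < i)%N -> (100 * 1000) <= u * L ^+ i.
Proof.
move=> i0; apply: (le_trans uL); rewrite ler_pM2l // -{1}[L]expr1.
exact: Lx_le.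
Qed.

Lemma light_cut_le_heavy : light_cut <= heavy_cut.
Proof.
rewrite /light_cut /heavy_cut ler_pdivrMr // mulrAC ler_peMl //.
by apply: le_trans (u_pow (isT : (0 < 5)%N)); lra.
Qed.

(** The overlaps of the neighbourhoods that are not light amount to O(L^14), negligible against
    K. *)
Lemma overlap_le : (t1 ^ 2 * (r * S))%:R <= K.
Proof.
rewrite natrM natrX natrM.
apply: (@le_trans _ _ ((3 * L ^+ 5) ^+ 2 * (7 * L * (4 * L ^+ 3)))).
  by rewrite !ler_pM ?mulr_ge0 ?exprn_ge0 ?lerXn2r ?nnegrE // mulr_ge0.
have -> : (3 * L ^+ 5) ^+ 2 * (7 * L * (4 * L ^+ 3)) = 252 * L ^+ 14 by ring.
by apply: pow_le_K => //; lra.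
Qed.

Lemma big_count_le : k%:R + (t1 ^ 2 * (r * S))%:R <= t1%:R * light_cut.
Proof.
apply: (@le_trans _ _ (2 * K)); first by have := overlap_le; rewrite /K; lra.
by rewrite /light_cut mulrA ler_pdivlMr // mulrAC ler_pM2r.
Qed.

Lemma heavy_count_le : k%:R + (t1 ^ 2 * (r * S))%:R <= t0%:R * heavy_cut.
Proof.
apply: (@le_trans _ _ (2 * K)); first by have := overlap_le; rewrite /K; lra.
by rewrite /heavy_cut mulrA ler_pM2r.
Qed.

Lemma same_label_le : (k * S)%:R <= u * K ^+ 2.
Proof.
rewrite natrM expr2 mulrCA ler_pM2l //; apply: (le_trans SP1).
have h1 : (100 * 1000) * (4 * L ^+ 3) <= (100 * 1000) * (u * K).
  apply: (@le_trans _ _ (u * L * (4 * L ^+ 3))).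
    by rewrite ler_pM2r // mulr_gt0.
  have -> : u * L * (4 * L ^+ 3) = u * (4 * L ^+ 4) by ring.
  have h4 : 4 * L ^+ 4 <= K by apply: pow_le_K => //; lra.
  by have := ler_wpM2l u_ge0 h4; have := mulr_ge0 u_ge0 K_ge0; lra.
by move: h1; lra.
Qed.

Lemma light_cut_mul_le : light_cut * S%:R <= 4 * K / L ^+ 2.
Proof.
apply: (@le_trans _ _ (light_cut * (4 * L ^+ 3))); first by rewrite ler_wpM2l // light_cut_ge0.
have L0 : L != 0 by rewrite gt_eqF.
by rewrite /light_cut le_eqVlt; apply/orP; left; apply/eqP; field.
Qed.

Lemma degree_le : d%:R <= 5 * K / L ^+ 3.
Proof. by rewrite ler_pdivlMr. Qed.

Lemma closed_capP : (k * S)%:R + (light_cap + 2 * light_cut * S%:R * edge_cap) +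
  heavy_cut * (k + t1 ^ 2 * (r * S))%:R + (light_cap + 2 * d%:R * edge_cap) <= closed_cap.
Proof.
have L0 : L != 0 by rewrite gt_eqF.
have y0 : 0 <= edge_cap by rewrite /edge_cap !mulr_ge0.
have h1 : 2 * light_cut * S%:R * edge_cap <= u * K ^+ 2.
  apply: (@le_trans _ _ (2 * (4 * K / L ^+ 2) * edge_cap)).
    by rewrite ler_wpM2r // -mulrA ler_wpM2l // light_cut_mul_le.
  have -> : 2 * (4 * K / L ^+ 2) * edge_cap = 48 / L * K ^+ 2 by rewrite /edge_cap; field.
  rewrite ler_pM2r ?exprn_gt0 // ler_pdivrMr //; apply: le_trans uL; lra.
have h2 : heavy_cut * (k + t1 ^ 2 * (r * S))%:R <= 2 * (u * K ^+ 2).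
  rewrite /heavy_cut natrD; apply: (@le_trans _ _ (u * K * (K + K))).
    by rewrite ler_wpM2l ?lerD2l ?overlap_le // mulr_ge0.
  by rewrite expr2; lra.
have h3 : 2 * d%:R * edge_cap <= u * K ^+ 2.
  apply: (@le_trans _ _ (2 * (5 * K / L ^+ 3) * edge_cap)).
    by rewrite ler_wpM2r // ler_wpM2l // degree_le.
  have -> : 2 * (5 * K / L ^+ 3) * edge_cap = 60 / L ^+ 2 * K ^+ 2 by rewrite /edge_cap; field.
  rewrite ler_pM2r ?exprn_gt0 // ler_pdivrMr //.
  by apply: le_trans (u_pow (isT : (0 < 2)%N)); lra.
have := same_label_le; rewrite /light_cap /closed_cap; lra.
Qed.

Lemma light_rate_ge0 : 0 <= light_rate.
Proof. by apply: divr_ge0; apply: mulr_ge0. Qed.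

Lemma inv_small (c : R) i : (0 < i)%N -> c <= 5 * (10 * 1000) -> c / (u * L ^+ i) <= 2^-1.
Proof.
move=> i0 hc; rewrite ler_pdivrMr ?mulr_gt0 //.
by have := u_pow i0; move: hc; lra.
Qed.

Lemma light_rate_S : light_rate * light_cut * S%:R <= 2^-1.
Proof.
have L0 : L != 0 by rewrite gt_eqF.
have K0 : K != 0 by rewrite gt_eqF.
have u0 : u != 0 by rewrite gt_eqF.
rewrite -mulrA; apply: (@le_trans _ _ (light_rate * (4 * K / L ^+ 2))).
  by rewrite ler_wpM2l ?light_rate_ge0 ?light_cut_mul_le.
have -> : light_rate * (4 * K / L ^+ 2) = 24 / (u * L ^+ 1) by rewrite /light_rate; field; rewrite L0 u0 K0.
by apply: inv_small => //; lra.
Qed.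

Lemma light_rate_k : light_rate * light_cut * k%:R * edge_prob <= 2^-1.
Proof.
have L0 : L != 0 by rewrite gt_eqF.
have K0 : K != 0 by rewrite gt_eqF.
have u0 : u != 0 by rewrite gt_eqF.
have -> : light_rate * light_cut * k%:R * edge_prob = 15 / 2 / (u * L ^+ 3).
  by rewrite -/K /light_rate /light_cut /edge_prob; field; rewrite L0 u0 K0.
by apply: inv_small => //; lra.
Qed.

Lemma light_rate_d : light_rate * d%:R <= 2^-1.
Proof.
have L0 : L != 0 by rewrite gt_eqF.
have K0 : K != 0 by rewrite gt_eqF.
have u0 : u != 0 by rewrite gt_eqF.
apply: (@le_trans _ _ (light_rate * (5 * K / L ^+ 3))).
  by rewrite ler_wpM2l ?light_rate_ge0 ?degree_le.
have -> : light_rate * (5 * K / L ^+ 3) = 30 / (u * L ^+ 2) by rewrite /light_rate; field; rewrite L0 u0 K0.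
by apply: inv_small => //; lra.
Qed.

Lemma light_rate_dk : light_rate * d%:R * k%:R * edge_prob <= 2^-1.
Proof.
have L0 : L != 0 by rewrite gt_eqF.
have K0 : K != 0 by rewrite gt_eqF.
have u0 : u != 0 by rewrite gt_eqF.
rewrite -mulrA; apply: (@le_trans _ _ (light_rate * (5 * K / L ^+ 3) * (K * edge_prob))).
  rewrite ler_wpM2r ?ler_wpM2l ?light_rate_ge0 ?degree_le // mulr_ge0 ?edge_prob_ge0 //.
have -> : light_rate * (5 * K / L ^+ 3) * (K * edge_prob) = 75 / 2 / (u * L ^+ 1).
  by rewrite /light_rate /edge_prob; field; rewrite L0 u0 K0.
by apply: inv_small => //; lra.
Qed.

Lemma degree_rate_gt0 : 0 < degree_rate.
Proof. by rewrite invr_gt0 mulr_gt0. Qed.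

Lemma degree_rate_S : degree_rate * S%:R <= 100^-1.
Proof. by rewrite /degree_rate mulrC ler_pdivrMr ?mulr_gt0 //; move: SP1; lra. Qed.

Lemma exc_le : exc_bound m k edge_prob edge_cap light_cap closed_cap slack (40 * 1000) light_rate <= 5 * expR (- (3 * (K * L))).
Proof.
have L0 : L != 0 by rewrite gt_eqF.
have K0 : K != 0 by rewrite gt_eqF.
have u0 : u != 0 by rewrite gt_eqF.
have e1 : light_rate * (m%:R * (16 * (k%:R * edge_prob) ^+ 2) - light_cap) <= - (3 * (K * L)).
  have -> : - (3 * (K * L)) = light_rate * (- (u * K ^+ 2 / 2)).
    by rewrite /light_rate; field; rewrite u0 K0.
  rewrite ler_wpM2l ?light_rate_ge0 // -/K mulrC mulrC [K * edge_prob]mulrC edge_probK /light_cap.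
  have -> : m%:R * (16 * (5 / 4 * L) ^+ 2) = 25 / L ^+ 2 * (m%:R * L ^+ 4) by field.
  have h : 25 / L ^+ 2 * (m%:R * L ^+ 4) <= 25 / L ^+ 2 * K ^+ 2.
    by rewrite ler_wpM2l // divr_ge0.
  have h2 : 25 / L ^+ 2 * K ^+ 2 <= u / 2 * K ^+ 2.
    rewrite ler_pM2r ?exprn_gt0 // ler_pdivrMr //.
    by have := u_pow (isT : (0 < 2)%N); lra.
  by move: h h2; lra.
have e2 : 3 / 2 * edge_prob * k%:R ^+ 2 - edge_cap <= - (3 * (K * L)).
  have -> : 3 / 2 * edge_prob * k%:R ^+ 2 = 3 / 2 * (edge_prob * K) * K by rewrite /K; ring.
  by rewrite edge_probK /edge_cap; have := mulr_gt0 K_gt0 L_gt0; lra.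
(* The moment parameter 40000 turns [slack] into 4 K L, while e^40000 u = 1/9 keeps the mean term at
   35/36 K L. *)
have e3 : edge_prob * (expR (40 * 1000) - 1) * closed_cap - (40 * 1000) * slack <= - (3 * (K * L)).
  have -> : edge_prob * (expR (40 * 1000) - 1) * closed_cap = (edge_prob * K) * K * 7 * ((expR (40 * 1000) - 1) * u).
    by rewrite /closed_cap; ring.
  rewrite edge_probK.
  have ue : (expR (40 * 1000) - 1) * u <= 9^-1.
    by move: uE u_gt0; lra.
  have KL0 := mulr_gt0 K_gt0 L_gt0.
  have h : 5 / 4 * L * K * 7 * ((expR (40 * 1000) - 1) * u) <= 5 / 4 * L * K * 7 * 9^-1.
    by rewrite ler_wpM2l // ; lra.
  by move: h; rewrite /slack; lra.
rewrite /exc_bound.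
by rewrite -ler_expR in e1; rewrite -ler_expR in e2; rewrite -ler_expR in e3; lra.
Qed.

Lemma m_le : m%:R <= expR (2 * L) / 2.
Proof.
have -> : expR (2 * L) = K ^+ 2 by rewrite KE -expRM_natl.
have h : 2 <= L ^+ 4.
  apply: le_trans (Lx_le (isT : (1 <= 4)%N)); apply: le_trans L_large; lra.
have : m%:R * 2 <= m%:R * L ^+ 4 by rewrite ler_wpM2l.
by move: mP1; lra.
Qed.

Lemma K_over_L (c : R) : c <= (10 * 1000) -> c * L <= K / L ^+ 3.
Proof.
move=> hc; rewrite ler_pdivlMr // -mulrA -exprS; apply: pow_le_K => //.
by apply: (le_trans hc); lra.
Qed.

Lemma expR_decay (x : R) : x <= - (3 * L) -> m%:R * expR x <= L^-1.
Proof.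
move=> hx; apply: (@le_trans _ _ (expR (2 * L) * expR x)).
  rewrite ler_wpM2r ?expR_ge0 //; apply: le_trans m_le _.
  by have := expR_ge0 (2 * L); lra.
rewrite -expRD; apply: le_trans (expRN_le L_gt0); rewrite ler_expR; lra.
Qed.

Lemma typ_le : typ_bound n m S d r edge_prob degree_cap degree_rate <= 3 / L.
Proof.
have L0 : L != 0 by rewrite gt_eqF.
have K0 : K != 0 by rewrite gt_eqF.
have e1 : m%:R * expR (3 * edge_prob * m%:R - d%:R) <= L^-1.
  apply: expR_decay.
  have h1 : 3 * edge_prob * m%:R <= 15 / 4 * (K / L ^+ 3).
    have -> : 3 * edge_prob * m%:R = 15 / 4 * (m%:R * L ^+ 4 / (K * L ^+ 3)).
      by rewrite /edge_prob; field; rewrite L0 K0.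
    rewrite ler_pM2l ?divr_gt0 // ler_pdivrMr ?mulr_gt0 //.
    by have -> : K / L ^+ 3 * (K * L ^+ 3) = K ^+ 2 by field.
  have h2 : 5 * (K / L ^+ 3) <= d%:R + 1 by rewrite mulrA ler_pdivrMr.
  have h3 : 4 * L <= K / L ^+ 3 by apply: K_over_L; lra.
  by have := L_ge1; lra.
have e2 : m%:R * expR (degree_rate * (edge_prob * n%:R * (1 + 2 * (degree_rate * S%:R)) - degree_cap)) <= L^-1.
  apply: expR_decay.
  have pn : edge_prob * n%:R <= 5 / 12 * K.
    have -> : edge_prob * n%:R = 5 / 12 * (n%:R * (3 * L) / K) by rewrite /edge_prob; field.
    by rewrite ler_pM2l ?divr_gt0 // ler_pdivrMr // -expr2.
  have h1 : edge_prob * n%:R * (1 + 2 * (degree_rate * S%:R)) <= 5 / 12 * K * (1 + 2 / 100).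
    apply: ler_pM => //; first by rewrite mulr_ge0 ?edge_prob_ge0.
      by rewrite addr_ge0 // !mulr_ge0 // ltW // degree_rate_gt0.
    by have := degree_rate_S; lra.
  have h2 : edge_prob * n%:R * (1 + 2 * (degree_rate * S%:R)) - degree_cap <= - (5 / 1000 * K).
    by move: h1; rewrite /degree_cap; lra.
  apply: (@le_trans _ _ (degree_rate * - (5 / 1000 * K))); first by rewrite ler_pM2l ?degree_rate_gt0.
  have -> : degree_rate * - (5 / 1000 * K) = - (K / L ^+ 3) / (80 * 1000) by rewrite /degree_rate; field.
  have h3 : 3 * (80 * 1000) * L <= K / L ^+ 3.
    rewrite ler_pdivlMr //.
    have -> : 3 * (80 * 1000) * L * L ^+ 3 = 3 * (80 * 1000) * L ^+ 4 by ring.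
    apply: (@le_trans _ _ ((100 * 1000) * L ^+ 5)).
      by have := ler_wpM2r (Lx_ge0 4) L_large; have := Lx_ge0 4; lra.
    exact: pow_le_K.
  lra.
have e3 : m%:R ^+ 2 * expR (3 * edge_prob ^+ 2 * m%:R - r%:R) <= L^-1.
  have h1 : 3 * edge_prob ^+ 2 * m%:R <= 3.
    have -> : 3 * edge_prob ^+ 2 * m%:R = 75 / 16 * (m%:R * L ^+ 4) / (K ^+ 2 * L ^+ 2).
      by rewrite /edge_prob; field; rewrite L0 K0.
    rewrite ler_pdivrMr ?mulr_gt0 ?exprn_gt0 //.
    have : 75 / 16 * (m%:R * L ^+ 4) <= 75 / 16 * K ^+ 2 by rewrite ler_pM2l // divr_gt0.
    have : K ^+ 2 * 2 <= K ^+ 2 * L ^+ 2.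
      rewrite ler_pM2l ?exprn_gt0 //; apply: le_trans (Lx_le (isT : (1 <= 2)%N)).
      by apply: le_trans L_large; lra.
    by have := sqr_ge0 K; lra.
  apply: (@le_trans _ _ (expR (4 * L) * expR (- (5 * L)))).
    apply: ler_pM; rewrite ?expR_ge0 ?sqr_ge0 //.
      have -> : 4 * L = 2%:R * (2 * L) by ring.
      rewrite expRM_natl; apply: lerXn2r; rewrite ?nnegrE ?expR_ge0 //.
      by apply: (le_trans m_le); have := expR_ge0 (2 * L); lra.
    by rewrite ler_expR; move: rP2 L_large; lra.
  by rewrite -expRD; apply: le_trans (expRN_le L_gt0); rewrite ler_expR; lra.
by rewrite /typ_bound; lra.
Qed.

(** C(n, k) <= (e n / k)^k, and e n <= 4 n <= 3 L n <= K^2, so the base is at most K. *)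
Lemma bin_n_k_le : 'C(n, k)%:R <= expR (K * L).
Proof.
apply: le_trans (bin_le_expR R n k_gt0) _.
rewrite -/K -{2}[K]mulr1 expRM_natl -exprMn /K [_ * L]mulrC expRM_natr -/K.
apply: lerXn2r; rewrite ?nnegrE ?mulr_ge0 ?expR_ge0 ?invr_ge0 //.
rewrite -KE; apply: (@le_trans _ _ (n%:R / K * 4)).
  by rewrite ler_wpM2l ?expR1_le4 // divr_ge0.
rewrite mulrAC ler_pdivrMr // -expr2; apply: le_trans nP.
by rewrite ler_wpM2l //; have := L_large; lra.
Qed.

Lemma graph_numeric :
  2 * typ_bound n m S d r edge_prob degree_cap degree_rate +
  'C(n, k)%:R * (2 * exc_bound m k edge_prob edge_cap light_cap closed_cap slack (40 * 1000) light_rate) + 2^-1 < 1.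
Proof.
have h1 := typ_le.
have h2 : 3 / L <= 10^-1.
  by rewrite ler_pdivrMr //; have := L_large; lra.
have KL1 : (100 * 1000) <= K * L.
  apply: (le_trans L_large); rewrite ler_peMl //.
  by rewrite -[1]mulr1 -(expr0 L); apply: pow_le_K => //; lra.
have h3 : 'C(n, k)%:R * (2 * exc_bound m k edge_prob edge_cap light_cap closed_cap slack (40 * 1000) light_rate) <= 10^-1.
  apply: (@le_trans _ _ (expR (K * L) * (2 * (5 * expR (- (3 * (K * L))))))).
    have e0 : 0 <= exc_bound m k edge_prob edge_cap light_cap closed_cap slack (40 * 1000) light_rate.
      by rewrite /exc_bound !addr_ge0 ?mulr_ge0 ?expR_ge0.
    apply: ler_pM => //; [by rewrite mulr_ge0|exact: bin_n_k_le|].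
    by rewrite ler_pM2l // exc_le.
  have -> : expR (K * L) * (2 * (5 * expR (- (3 * (K * L))))) =
      10 * expR (- (2 * (K * L))).
    have -> : - (2 * (K * L)) = K * L + - (3 * (K * L)) by ring.
    by rewrite expRD; ring.
  have KL2 : 0 < 2 * (K * L) by move: KL1; lra.
  have := expRN_le KL2.
  have : (2 * (K * L))^-1 <= 100^-1.
    by rewrite lef_pV2 ?posrE //; move: KL1; lra.
  lra.
lra.
Qed.

Lemma heavy_error_le : (t0 * d)%:R + (t0 ^ 2 * (r * S))%:R <= K / 1000.
Proof.
have L0 : L != 0 by rewrite gt_eqF.
have h1 : (t0 * d)%:R <= K / 2000.
  rewrite natrM; apply: (@le_trans _ _ (L / 1000 * (5 * K / L ^+ 3))).
    by apply: ler_pM => //; exact: degree_le.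
  have -> : L / 1000 * (5 * K / L ^+ 3) = K * (5 / 1000 / L ^+ 2) by field.
  rewrite ler_pM2l // ler_pdivrMr //.
  by have := Lx_le (isT : (1 <= 2)%N); have := L_large; rewrite expr1; lra.
have h2 : (t0 ^ 2 * (r * S))%:R <= K / 2000.
  rewrite natrM natrX natrM.
  apply: (@le_trans _ _ (L ^+ 2 * (7 * L * (4 * L ^+ 3)))).
    have t0L : t0%:R <= L by apply: (le_trans t0P1); have := L_ge0; lra.
    by rewrite !ler_pM ?mulr_ge0 ?lerXn2r ?nnegrE.
  have -> : L ^+ 2 * (7 * L * (4 * L ^+ 3)) = 28 * L ^+ 6 by ring.
  have : (60 * 1000) * L ^+ 6 <= K by apply: pow_le_K => //; lra.
  by have := Lx_ge0 6; lra.
lra.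
Qed.

(** The union bound over heavy families costs only O(K / L) in the exponent, as [d] is of order K /
    L^3 and [t0] at most L / 1000. *)
Lemma family_count_le : ((m.+1 ^ d) ^ t0)%:R <= expR (K / (100 * L)).
Proof.
have L0 : L != 0 by rewrite gt_eqF.
rewrite -expnM natrX; apply: (@le_trans _ _ (expR (2 * L) ^+ (d * t0))).
  apply: lerXn2r; rewrite ?nnegrE ?expR_ge0 //.
  have := m_le; have : 2 <= expR (2 * L).
    by apply: le_trans (expR_ge1Dx _); have := L_ge1; lra.
  rewrite -[m.+1%:R]natr1; lra.
rewrite -expRM_natr ler_expR natrM.
apply: (@le_trans _ _ (2 * L * (5 * K / L ^+ 3 * (L / 1000)))).
  rewrite ler_wpM2l // ?mulr_ge0 //; apply: ler_pM => //; exact: degree_le.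
have -> : 2 * L * (5 * K / L ^+ 3 * (L / 1000)) = K / (100 * L) by field.
by [].
Qed.

(** C(m, j) (j / m)^j is at most e^j, and each of the other k - j factors is at most 2 L^4 / K,
    which is K^(-1) up to a small power. *)
Lemma image_prob_le (j : nat) : (0 < j)%N -> (j <= k)%N ->
  'C(m, j)%:R * (j%:R / m%:R) ^+ k <= expR (K - 999 / 1000 * L * (K - j%:R)).
Proof.
move=> j0 jk.
have m0 : 0 < m%:R :> R by rewrite ltr0n.
have j0' : 0 < j%:R :> R by rewrite ltr0n.
have -> : (j%:R / m%:R) ^+ k = (j%:R / m%:R) ^+ j * (j%:R / m%:R) ^+ (k - j) :> R.
  by rewrite -exprD subnKC.
have jm0 : 0 <= j%:R / m%:R :> R by rewrite divr_ge0.
apply: (@le_trans _ _ (expR j%:R * (j%:R / m%:R) ^+ (k - j))).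
  rewrite mulrA ler_wpM2r ?exprn_ge0 //.
  apply: le_trans (ler_wpM2r (exprn_ge0 _ jm0) (bin_le_expR R m j0)) _.
  rewrite mulrAC -exprMn mulrA mulfVK ?gt_eqF // mulfV ?gt_eqF //.
  by rewrite expr1n mul1r.
rewrite expRD; apply: ler_pM; rewrite ?expR_ge0 ?exprn_ge0 //.
  by rewrite ler_expR /K ler_nat.
have -> : - (999 / 1000 * L * (K - j%:R)) = - (999 / 1000 * L) * (k - j)%:R.
  by rewrite natrB // /K; ring.
rewrite expRM_natr; apply: lerXn2r; rewrite ?nnegrE ?expR_ge0 //.
apply: (@le_trans _ _ (2 * L ^+ 4 / K)).
  rewrite ler_pdivrMr // mulrAC ler_pdivlMr //.
  apply: (@le_trans _ _ (K * K)); first by rewrite ler_pM2r // /K ler_nat.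
  by move: mP2; rewrite expr2; lra.
apply: (@le_trans _ _ (expR (L / 1000) / K)); first by rewrite ler_pM2r ?invr_gt0.
by rewrite KE -expRN -expRD ler_expR; lra.
Qed.

(* The quadratic is minimal at [a = 0.415], with value above [0.517]. *)
Lemma exponent_le (a ze iK e2 iL : R) :
  0 <= a -> a <= 1 -> 0 <= ze -> ze <= 200^-1 -> 0 <= iK -> iK <= 1000^-1 ->
  0 <= e2 -> e2 <= 1000^-1 -> 0 <= iL -> iL <= 1000^-1 ->
  iL + 2 / 1000 - (1 - ze) * (5 / 8 * ((1 - a) ^+ 2 - (1 - a) * iK - 43 / 100 * (a + e2))) +
    iL - 999 / 1000 * a <= - (501 / 1000).
Proof.
move=> a0 a1 z0 ze1 i0 i1 e0 e1 l0 l1.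
set Y := (1 - a) ^+ 2 - (1 - a) * iK - 43 / 100 * (a + e2).
have Y1 : Y <= 1.
  have : (1 - a) ^+ 2 <= 1 by rewrite expr2; nra.
  have : 0 <= (1 - a) * iK by rewrite mulr_ge0 // subr_ge0.
  rewrite /Y; lra.
have zY : ze * Y <= 200^-1.
  apply: (@le_trans _ _ (ze * 1)); first by rewrite ler_wpM2l.
  by rewrite mulr1.
have ai : (1 - a) * iK <= 1000^-1.
  apply: (@le_trans _ _ (1 * iK)); last by rewrite mul1r.
  by rewrite ler_wpM2r //; lra.
have sq : 0 <= (a - 415 / 1000) ^+ 2 by exact: sqr_ge0.
move: zY ai sq; rewrite /Y !expr2; lra.
Qed.

Lemma expRN20_le : expR (- 20) <= 200^-1 :> R.
Proof.
rewrite expRN lef_pV2 ?posrE ?expR_gt0 //.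
have x0 : 0 <= 20 :> R by [].
by apply: le_trans (expR_ge1Dxn 1 x0); rewrite !factS fact0 !expr2; lra.
Qed.

(** Divided by K L, the exponent is the quadratic of [exponent_le]. A constant just above 1/2
    suffices, since the square for the two projections must beat C(n, k) <= exp (K L). *)
Lemma term_le (j : nat) : (0 < j)%N -> (j <= k)%N ->
  side_bound m k S d r t0 edge_prob degree_cap slack 20 j * ('C(m, j)%:R * (j%:R / m%:R) ^+ k) <=
  expR (- (501 / 1000) * (K * L)).
Proof.
move=> j0 jk.
have L0 : L != 0 by rewrite gt_eqF.
have K0 : K != 0 by rewrite gt_eqF.
(* The relative deficit of blocks, 1 - j / K; [e2] below collects the errors of [heavy_bound]. *)
pose a := (K - j%:R) / K.
pose e2 := ((t0 * d)%:R + (t0 ^ 2 * (r * S))%:R) / K.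
have jK : j%:R <= K by rewrite ler_nat.
have pE : edge_prob * (1 - expR (- 20)) * ((j%:R ^+ 2 - j%:R) / 2 - heavy_bound k S d r t0 degree_cap j) =
   (K * L) * ((1 - expR (- 20)) * (5 / 8 * ((1 - a) ^+ 2 - (1 - a) * K^-1 - 43 / 100 * (a + e2)))).
  by rewrite /edge_prob /heavy_bound /degree_cap /a /e2 -/K; field.
apply: (@le_trans _ _ (expR (K / (100 * L)) * expR (20 * slack -
    edge_prob * (1 - expR (- 20)) * ((j%:R ^+ 2 - j%:R) / 2 - heavy_bound k S d r t0 degree_cap j)) *
    expR (K - 999 / 1000 * L * (K - j%:R)))).
  apply: ler_pM; rewrite ?mulr_ge0 ?exprn_ge0 ?divr_ge0 ?expR_ge0 //.
    by rewrite ler_wpM2r ?expR_ge0 // family_count_le.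
  exact: image_prob_le.
rewrite -!expRD ler_expR pE.
have KL0 : 0 < K * L by rewrite mulr_gt0.
have hK : K / (100 * L) <= (K * L) * L^-1.
  rewrite mulfK // ler_pdivrMr ?mulr_gt0 // ler_peMr //.
  by have := L_ge1; lra.
have zE : 20 * slack = (K * L) * (2 / 1000) by rewrite /slack; field.
have KE2 : K - 999 / 1000 * L * (K - j%:R) = (K * L) * (L^-1 - 999 / 1000 * a).
  by rewrite /a; field; rewrite K0 L0.
rewrite zE KE2.
have i1000 (x : R) : 1000 <= x -> x^-1 <= 1000^-1.
  by move=> hx; rewrite lef_pV2 ?posrE //; apply: lt_le_trans hx.
have iL : L^-1 <= 1000^-1 by apply: i1000; have := L_large; lra.
have iK : K^-1 <= 1000^-1.
  apply: i1000; rewrite -[leLHS]mulr1 -(expr0 L); apply: pow_le_K => //; lra.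
have e2_le : e2 <= 1000^-1 by rewrite ler_pdivrMr // mulrC heavy_error_le.
have e2_ge0 : 0 <= e2 by apply: divr_ge0 => //; rewrite addr_ge0.
have a_ge0 : 0 <= a by rewrite divr_ge0 // subr_ge0.
have a_le1 : a <= 1 by rewrite ler_pdivrMr // mul1r gerBl.
have iL0 : 0 <= L^-1 by rewrite invr_ge0.
have iK0 : 0 <= K^-1 by rewrite invr_ge0.
have br := exponent_le a_ge0 a_le1 (expR_ge0 _) expRN20_le iK0 iK e2_ge0 e2_le iL0 iL.
move: hK (ler_wpM2l (ltW KL0) br); lra.
Qed.

Lemma side_ge0 j : 0 <= side_bound m k S d r t0 edge_prob degree_cap slack 20 j.
Proof. by rewrite /side_bound mulr_ge0 // expR_ge0. Qed.

Lemma projection_numeric :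
  2 * (m%:R * expR (3 * n%:R / m%:R - S%:R)) +
  2 * ('C(n, k)%:R * image_bound m k (side_bound m k S d r t0 edge_prob degree_cap slack 20) ^+ 2) < 1.
Proof.
have m0 : 0 < m%:R :> R by rewrite ltr0n.
have h1 : m%:R * expR (3 * n%:R / m%:R - S%:R) <= L^-1.
  apply: expR_decay.
  have nm : 3 * n%:R / m%:R <= 2 * L ^+ 3.
    rewrite ler_pdivrMr // -(ler_pM2r L_gt0).
    apply: (@le_trans _ _ (K ^+ 2)); first by move: nP; lra.
    apply: (le_trans mP2); lra.
  have := Lx_le (isT : (2 <= 3)%N); have : 3 * L <= L ^+ 2.
    by rewrite expr2 ler_pM2r //; have := L_large; lra.
  by move: SP2; lra.
have K1 : 100 * 1000 <= K.
  by rewrite -[leLHS]mulr1 -(expr0 L); apply: pow_le_K.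
have h2 : image_bound m k (side_bound m k S d r t0 edge_prob degree_cap slack 20) <=
    2 * K * expR (- (501 / 1000) * (K * L)).
  apply: (@le_trans _ _ (\sum_(j < k.+1) expR (- (501 / 1000) * (K * L)))).
    (* The term j = 0 vanishes because 0^k = 0 for positive [k]. *)
    apply: ler_sum => j _; case: (posnP j) => [->|j0]; last by apply: term_le; rewrite // -ltnS.
    by rewrite mul0r expr0n gtn_eqF ?k_gt0 // mulr0 mulr0 expR_ge0.
  rewrite sumr_const card_ord -[_ *+ k.+1]mulr_natl ler_wpM2r ?expR_ge0 //.
  by rewrite -[k.+1%:R]natr1 -/K; move: K1; lra.
have ib0 : 0 <= image_bound m k (side_bound m k S d r t0 edge_prob degree_cap slack 20).
  by apply: sumr_ge0 => j _; rewrite !mulr_ge0 ?exprn_ge0 ?divr_ge0 ?expR_ge0.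
have h3 : 'C(n, k)%:R * image_bound m k (side_bound m k S d r t0 edge_prob degree_cap slack 20) ^+ 2 <=
    4 * L^-1.
  (* The exponents add to K L - 1.002 K L, and the remaining 0.002 K L absorbs K^2 = exp (2 L). *)
  apply: (@le_trans _ _ (expR (K * L) * (2 * K * expR (- (501 / 1000) * (K * L))) ^+ 2)).
    apply: ler_pM; rewrite ?exprn_ge0 ?bin_n_k_le //.
    by apply: lerXn2r; rewrite ?nnegrE ?mulr_ge0 ?expR_ge0.
  have -> : (2 * K * expR (- (501 / 1000) * (K * L))) ^+ 2 =
      4 * (expR (2%:R * L) * expR (2%:R * (- (501 / 1000) * (K * L)))).
    by rewrite !expRM_natl -KE; ring.
  rewrite mulrCA -!expRD ler_pM2l //; apply: le_trans (expRN_le L_gt0).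
  rewrite ler_expR.
  have : 100 * 1000 * L <= K * L by rewrite ler_pM2r.
  have := L_gt0; lra.
have iL : L^-1 <= 100^-1.
  by rewrite lef_pV2 ?posrE //; have := L_large; lra.
lra.
Qed.


Lemma two_bite_exists : exists e : rel 'I_n,
  [/\ symmetric e, irreflexive e, forall x v w, e x v -> e v w -> ~~ e x w
    & forall I : {set 'I_n}, #|I| = k -> exists x v, [/\ x \in I, v \in I & e x v]].
Proof.
have [pe [pc [peS pcS sumle]]] := good_projections m_gt0 side_ge0 projection_numeric.
have xk0 : 0 <= degree_cap by rewrite /degree_cap mulr_ge0 // divr_ge0.
have txS2 : degree_rate * S%:R <= 2^-1 by have := degree_rate_S; lra.
have la0 : 0 <= 20 :> R by [].
have T0 : 0 <= 40 * 1000 :> R by rewrite mulr_ge0.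
have [|g [h nind]] := @good_graph R n m k S d r t0 t1 edge_prob light_cut heavy_cut degree_cap edge_cap light_cap closed_cap slack 20 (40 * 1000)
  light_rate degree_rate edge_prob_ge0 edge_prob_le1 k_gt0 xk0 light_cut_ge0 light_cut_le_heavy big_count_le heavy_count_le closed_capP la0 T0 light_rate_ge0
  light_rate_S light_rate_k light_rate_d light_rate_dk degree_rate_gt0 txS2 pe pc peS pcS.
  by apply: le_lt_trans graph_numeric; rewrite lerD2l.
exists (two_bite pe pc g h); split.
- by move=> x v; exact: two_bite_sym.
- by move=> x; exact: two_bite_irr.
- exact: two_bite_triangle.
move=> I /nind; rewrite negb_forall_in => /exists_inP[x xI].
by rewrite negb_forall_in => /exists_inP[w wI]; rewrite negbK => xw; exists x, w.
Qed.

End Numeric.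

Lemma nat_below (R : realType) (x : R) : 0 <= x -> exists a : nat, a%:R <= x /\ x <= a%:R + 1.
Proof.
move=> x0; exists (Num.truncn x); have /andP[h1 h2] := truncn_itv x0; split=> //.
by rewrite -[1]/(1%:R) -natrD addn1 ltW.
Qed.

(** * Integer parameters and large k *)

Section Existence.
Variables (R : realType) (n k : nat) (L u : R).
Hypotheses (u_gt0 : 0 < u) (u_le1 : u <= 1) (uE : expR (40 * 1000) * u = 9^-1).
Hypothesis KE : k%:R = expR L.
Hypothesis L_large : 100 * 1000 <= L.
Hypothesis uL : 100 * 1000 <= u * L.
Hypothesis K20 : L ^+ 20 <= k%:R.
Hypothesis L4 : 2 * L ^+ 4 <= expR (L / 1000).
Hypothesis nP : n%:R * (3 * L) <= k%:R ^+ 2.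

Lemma graph_exists_large : exists e : rel 'I_n,
  [/\ symmetric e, irreflexive e, forall x y z, e x y -> e y z -> ~~ e x z
    & forall I : {set 'I_n}, #|I| = k -> exists x y, [/\ x \in I, y \in I & e x y]].
Proof.
have L1 : 1 <= L by move: L_large; lra.
have L0 : 0 < L by lra.
have Lx i : 0 < L ^+ i by rewrite exprn_gt0.
have Lge1 i : 1 <= L ^+ i by rewrite exprn_ege1.
have K0 : 0 < k%:R :> R by rewrite KE expR_gt0.
have Lle i : (i <= 20)%N -> L ^+ i <= k%:R.
  by move=> hi; apply: le_trans K20; rewrite ler_weXn2l.
have Kge1 : 1 <= k%:R :> R by apply: le_trans (Lle 0%N isT); rewrite expr0.
(* Rounding a number of size at least 2 down by at most 1 keeps at least half of it, which is the
   slack allowed for [m]. *)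
have K2 : 2 <= k%:R ^+ 2 / L ^+ 4.
  rewrite ler_pdivlMr //; apply: (@le_trans _ _ (L ^+ 5)).
    by rewrite [L ^+ 5]exprS ler_pM2r //; move: L_large; lra.
  by apply: le_trans (Lle 5%N isT) _; rewrite expr2 ler_peMr // ltW.
have [m [m1 m2]] : exists a : nat, a%:R <= k%:R ^+ 2 / L ^+ 4 /\ k%:R ^+ 2 / L ^+ 4 <= a%:R + 1.
  by apply: nat_below; lra.
have [S [S1 S2]] := @nat_below R (4 * L ^+ 3) (mulr_ge0 (ler0n _ _) (ltW (Lx 3%N))).
have [d [d1 d2]] : exists a : nat, a%:R <= 5 * k%:R / L ^+ 3 /\ 5 * k%:R / L ^+ 3 <= a%:R + 1.
  by apply: nat_below; rewrite divr_ge0 ?mulr_ge0 // ltW.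
have [r [r1 r2]] := @nat_below R (7 * L) (mulr_ge0 (ler0n _ _) (ltW L0)).
have [t1 [t11 t12]] := @nat_below R (3 * L ^+ 5) (mulr_ge0 (ler0n _ _) (ltW (Lx 5%N))).
have [t0 [t01 t02]] : exists a : nat, a%:R <= L / 1000 /\ L / 1000 <= a%:R + 1.
  by apply: nat_below; rewrite divr_ge0 // ltW.
have mP1 : m%:R * L ^+ 4 <= k%:R ^+ 2 by rewrite -ler_pdivlMr.
have mP2 : k%:R ^+ 2 <= 2 * (m%:R * L ^+ 4).
  by rewrite mulrA -ler_pdivrMr //; lra.
have m_gt0 : (0 < m)%N by rewrite -(ltr_nat R); lra.
have SP2 : 3 * L ^+ 3 <= S%:R by have := Lge1 3%N; lra.
have dP1 : d%:R * L ^+ 3 <= 5 * k%:R by rewrite -ler_pdivlMr.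
have dP2 : 5 * k%:R <= (d%:R + 1) * L ^+ 3 by rewrite -ler_pdivrMr.
have t1P2 : 2 * L ^+ 5 <= t1%:R by have := Lge1 5%N; lra.
have t0P2 : 2 <= t0%:R * u.
  have := ler_wpM2r (ltW u_gt0) t02; move: uL u_le1; lra.
exact: (@two_bite_exists R n m k S d r t0 t1 L u).
Qed.

End Existence.

Lemma expR_ge_pow_large (R : realType) (i : nat) :
  exists2 B : R, 0 <= B & forall x, B <= x -> x ^+ i <= expR x.
Proof.
exists (i.+1)`!%:R => [|x Bx]; first exact: ler0n.
by apply: expR_ge_pow => //; apply: le_trans Bx; exact: ler0n.
Qed.

Lemma graph_exists (R : realType) : exists K0 : nat, forall k n : nat, (K0 <= k)%N ->
  1 < ln (k%:R : R) /\ (n%:R * (3 * ln k%:R) <= k%:R ^+ 2 :> R ->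
  exists e : rel 'I_n,
  [/\ symmetric e, irreflexive e, forall x y z, e x y -> e y z -> ~~ e x z
    & forall I : {set 'I_n}, #|I| = k -> exists x y, [/\ x \in I, y \in I & e x y]]).
Proof.
pose u : R := expR (- (40 * 1000)) / 9.
have u_gt0 : 0 < u by rewrite divr_gt0 ?expR_gt0.
have u_le1 : u <= 1.
  have : expR (- (40 * 1000)) <= 1 :> R.
    by rewrite -[leRHS]expR0 ler_expR oppr_le0 mulr_ge0.
  by rewrite /u; lra.
have uE : expR (40 * 1000) * u = 9^-1 by rewrite /u mulrA expRxMexpNx_1 mul1r.
have [B20 B20_ge0 pow20] := expR_ge_pow_large R 20.
have [B5 B5_ge0 pow5] := expR_ge_pow_large R 5.
have c0 : 0 <= 100 * 1000 / u by apply: divr_ge0; [rewrite mulr_ge0|exact: ltW].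
have p5 : 0 < 1000 ^+ 5 :> R by rewrite exprn_gt0.
(* The summands secure L^20 <= K, the fifth-power bound at L / 1000, the size of u L, the inequality
   2 L^4 <= (L / 1000)^5, and L >= 100000. *)
pose B := B20 + 1000 * B5 + 100 * 1000 / u + 2 * 1000 ^+ 5 + 100 * 1000.
exists (Num.truncn (expR B)).+1 => k n Kk.
have Bk : expR B <= k%:R by apply: ltW; apply: lt_le_trans (truncnS_gt _) _; rewrite ler_nat.
have k0 : 0 < k%:R :> R by apply: lt_le_trans Bk; exact: expR_gt0.
set L := ln k%:R.
have KE : k%:R = expR L by rewrite lnK // posrE.
have BL : B <= L by rewrite -ler_expR -KE.
have L_large : 100 * 1000 <= L by move: BL; rewrite /B; lra.
have L0 : 0 < L by move: L_large; lra.
split; first by move: L_large; lra.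
move=> nP; apply: (@graph_exists_large R n k L u) => //.
- rewrite [u * L]mulrC -ler_pdivrMr //; move: BL; rewrite /B; lra.
- by rewrite KE; apply: pow20; move: BL; rewrite /B; lra.
- apply: le_trans (pow5 _ _); last first.
    by rewrite ler_pdivlMr //; move: BL; rewrite /B; lra.
  rewrite expr_div_n ler_pdivlMr // [L ^+ 5]exprSr mulrAC mulrC ler_pM2l ?exprn_gt0 //.
  by move: BL; rewrite /B; lra.
Qed.

(** The construction reaches every [n] with 3 n log k <= k^2, so one threshold [K0] serves all [eps]
    at once; an [n] below the bound is of this kind and contradicts [ramsey3]. *)
Lemma ramsey3_lower_bound (R : realType) : exists K0 : nat, forall k n : nat, (K0 <= k)%N ->
  ramsey3 n k -> forall eps : R, 0 < eps ->
  (1 / 3 - eps) * k%:R ^+ 2 / ln k%:R <= n%:R.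
Proof.
have [K0 ex] := graph_exists R; exists K0 => k n Kk ram eps eps0.
have [lnk] := ex k n Kk.
have lnk0 : 0 < ln (k%:R : R) by apply: lt_trans lnk.
move=> exn; rewrite leNgt; apply/negP; rewrite ltr_pdivlMr // => lt.
have [|e [esym eirr etri eind]] := exn.
  have : 0 <= eps * k%:R ^+ 2 by rewrite mulr_ge0 ?sqr_ge0 // ltW.
  by move: lt; lra.
case: (ram e (conj esym eirr)) => [[x [y [z /and3P[xy yz xz]]]]|[I [ind Ik]]].
  by have := etri _ _ _ xy yz; rewrite xz.
have [x [y [xI yI xy]]] := eind I Ik.
by have := ind x y xI yI; rewrite xy.
Qed.

(* Transfer to the standard real numbers *)
From mathcomp Require Import Rstruct Rstruct_topology.
From Stdlib Require Import Reals.
Local Close Scope ring_scope.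

(* R(3,k) >= (1/3 - eps) k^2 / log k for k large: since R(3,k) is the least n
   with ramsey3 n k, this says every n with ramsey3 n k is at least the bound. *)
Theorem theorem1p1 :
  forall eps : R, (0 < eps)%R ->
  exists K : nat, forall k : nat, (K <= k)%N ->
    forall n : nat, ramsey3 n k ->
      ((1/3 - eps) * (INR k ^ 2) / ln (INR k) <= INR n)%R.
Proof.
move=> eps /RltP eps0; have [K0 bound] := ramsey3_lower_bound Rdefinitions.R.
exists K0 => k Kk n ram; apply/RleP; rewrite !RealsE.
exact: bound.
Qed.
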